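(* Let $r>0$, $0<\omega_0<\omega_1$, $M>0$ and $0<\varepsilon<1$. There exists a constant $\xi$, depending only on $r,\omega_0,\omega_1,\varepsilon,M$, such that for all real-valued functions $f,f_{\mathrm{app}}\in H^1(-r,r)$ satisfying $$\|f\|_{H^1(-r,r)}\le M,\qquad \|f_{\mathrm{app}}\|_{H^1(-r,r)}\le M,$$ one has $$\|f-f_{\mathrm{app}}\|_{L^2(-r,r)}^2\le \frac{(8\pi M^2)^{\varepsilon}}{\pi}\,\xi^2\,\|\mathcal F(f)-\mathcal F(f_{\mathrm{app}})\|_{L^2(\omega_0,\omega_1)}^{2-2\varepsilon}+\frac1\pi\|\mathcal F(f)-\mathcal F(f_{\mathrm{app}})\|_{L^2(\omega_0,\omega_1)}^2+\frac{8}{\omega_1^2}M^2 .$$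
   Context: Functions on $(-r,r)$ are extended by $0$ to $\mathbb R$, and the Fourier transform is $\mathcal F(f)(\omega)=\int_{\mathbb R} f(z)e^{-i\omega z}\,dz$. *)

(* Defs.v *)
From mathcomp Require Import all_boot all_order all_algebra.
From mathcomp Require Import complex.
From mathcomp Require Import all_classical all_reals all_analysis.

Set Implicit Arguments.
Unset Strict Implicit.
Unset Printing Implicit Defensive.

Import Order.TTheory GRing.Theory Num.Theory.
Import numFieldNormedType.Exports.

Local Open Scope classical_set_scope.
Local Open Scope ring_scope.
Local Open Scope complex_scope.

Section Definitions.
Context {R : realType}.
Implicit Types (A : set R) (f g phi : R -> R) (h : R -> R[i]).

Local Notation mu := (@lebesgue_measure R).

(* A function on [A] is represented by a total function on [R] whose values
   off [A] are irrelevant: it is always used through its extension by zero,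
   the restriction [f \_ A]. *)

Definition inL2 A f : Prop := (f \_ A : R -> R) \in Lfun mu 2%:E.

Definition L2norm A f : \bar R := 'N[mu]_(2%:E)[EFin \o (f \_ A)].

Definition L2normC A h : \bar R :=
  L2norm A (fun w => Normc.normc (h w)).

(* C_c^oo(A) *)
Definition test_function A phi : Prop :=
  (forall n x, derivable (derive1n n phi) x 1) /\
  compact (closure [set x | phi x != 0]) /\
  closure [set x | phi x != 0] `<=` A.

Definition weak_derivative A f g : Prop :=
  forall phi, test_function A phi ->
    \int[mu]_(x in A) (f x * derive1 phi x) = - \int[mu]_(x in A) (g x * phi x).

Definition inH1 A f : Prop :=
  inL2 A f /\ exists g, inL2 A g /\ weak_derivative A f g.

(* A representative of the weak derivative in L^2(A); the weak derivative is
   only determined up to a null set, which does not affect [H1norm]. *)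
Definition weakD A f : R -> R :=
  xget (cst 0) [set g | inL2 A g /\ weak_derivative A f g].

Definition H1norm A f : \bar R :=
  ((L2norm A f ^+ 2 + L2norm A (weakD A f) ^+ 2) `^ 2^-1)%E.

Definition expi (t : R) : R[i] := cos t +i* sin t.

Definition cintegral h : R[i] :=
  (\int[mu]_x complex.Re (h x)) +i* (\int[mu]_x complex.Im (h x)).

Definition fourier A f (w : R) : R[i] :=
  cintegral (fun z => ((f \_ A) z)%:C * expi (- (w * z))).

End Definitions.

(* Main.v *)
Require Import Defs.
From mathcomp Require Import all_boot all_order all_algebra.
From mathcomp Require Import complex.
From mathcomp Require Import all_classical all_reals all_analysis.
From mathcomp Require Import measurable_realfun ring lra.

(** The constant [xi] may depend on all the data, so the estimate reduces to a
    qualitative stability statement for the difference [g] of the two functions,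
    which satisfies [\int g ^+ 2 <= 4 * M ^+ 2] and
    [\int g' ^+ 2 <= 4 * M ^+ 2]. Let [D] be the norm of its Fourier transform
    on the band. By [L2_stability] there is a threshold [delta] such that
    [D < delta] forces [\int g ^+ 2 <= 8 * M ^+ 2 / omega1 ^+ 2], the last term
    of the bound. If [D >= delta], a large [xi] makes the first term exceed
    [4 * M ^+ 2].

    The stability statement expresses two facts: bounded sets of Sobolev
    functions on an interval are relatively compact among square integrable
    functions, and the Fourier transform of a compactly supported function,
    being analytic, is determined by its values on the band. Both are used in a
    direct form that needs neither subsequences nor inversion.

    For compactness, weak differentiability bounds the difference between the
    averages of [g] over two nearby intervals
    ([weak_derivative_average_diff]); the test functions are primitives of
    differences of smooth bumps. At Lebesgue points this bounds [g x] by the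
    average of [g] over a grid cell plus a small oscillation
    ([lebesgue_pt_bound]), so only finitely many integrals [\int_J g] have to
    be small.

    For analyticity, call [phi] controlled when [\int g * phi] is small,
    uniformly in [g], once [D] is. Controlled functions form a vector space that
    is closed under bounded pointwise limits ([controlled_lim]). It contains
    [cos (w * z)] and [sin (w * z)] for [w] in the band, because the transforms
    are equally Lipschitz ([controlled_band]); then, by differentiating in [w],
    their products with powers of [z] ([controlled_monomial]); then all
    polynomials, by [cos ^ 2 + sin ^ 2 = 1] and Taylor expansion
    ([controlled_poly]); and finally indicators of intervals, as limits of
    polynomials ([controlled_indic]). *)

Set Implicit Arguments.
Unset Strict Implicit.
Unset Printing Implicit Defensive.

Import Order.TTheory GRing.Theory Num.Theory.
Import numFieldNormedType.Exports.

Local Open Scope classical_set_scope.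
Local Open Scope ring_scope.

(** * Smooth bump functions *)

Section Smooth.
Context {R : realType}.
Implicit Types (f g : R -> R) (n k : nat).

(** Smoothness unfolded along the successive derivatives, so that closure
    under sums and products goes by induction on the order. *)
Fixpoint times_derivable n f : Prop :=
  if n is m.+1 then (forall x, derivable f x 1) /\ times_derivable m (derive1 f)
  else True.

Definition smooth f := forall n, times_derivable n f.

Lemma smooth_derivable f : smooth f ->
  forall n x, derivable (derive1n n f) x 1.
Proof.
move=> sf n x.
have : times_derivable n.+1 f by [].
elim: n f {sf} => [|n IH] f; first by case.
by rewrite derive1Sn => -[_ /IH].
Qed.

Lemma times_derivableS n f f' : (forall x : R, is_derive x 1 f (f' x)) ->
  times_derivable n f' -> times_derivable n.+1 f.
Proof.
move=> df tf'; split; first by move=> x; have [] := df x.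
suff -> : derive1 f = f' by [].
by apply/funext => x; rewrite derive1E; have [] := df x.
Qed.

Lemma times_derivable_pred n f : times_derivable n.+1 f -> times_derivable n f.
Proof. by elim: n f => [//|n IH] f [df /IH]. Qed.

Lemma derivable_is_derive f : (forall x, derivable f x 1) ->
  forall x : R, is_derive x 1 f (derive1 f x).
Proof. by move=> df x; rewrite derive1E; exact/derivableP. Qed.

Lemma times_derivableD n f g : times_derivable n f -> times_derivable n g ->
  times_derivable n (f + g).
Proof.
elim: n f g => [//|n IH] f g [df tf] [dg tg].
apply: (@times_derivableS _ _ (derive1 f + derive1 g)); last exact: IH.
by move=> x; apply: is_deriveD; exact: derivable_is_derive.
Qed.

Lemma times_derivableM n f g : times_derivable n f -> times_derivable n g ->
  times_derivable n (f * g).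
Proof.
elim: n f g => [//|n IH] f g tf tg.
have [[df tf'] [dg tg']] := (tf, tg).
apply: (@times_derivableS _ _ (f * derive1 g + g * derive1 f)).
  by move=> x; apply: is_deriveM; exact: derivable_is_derive.
by apply: times_derivableD; apply: IH => //; exact: times_derivable_pred.
Qed.

Lemma times_derivable_cst n (c : R) : times_derivable n (cst c).
Proof.
elim: n c => [//|n IH] c; apply: (@times_derivableS _ _ (cst 0)) => //.
Qed.

Lemma times_derivable_affine n f (a b : R) : times_derivable n f ->
  times_derivable n (fun x => f (a * x + b)).
Proof.
elim: n f => [//|n IH] f [df tf].
apply: (@times_derivableS _ _ (cst a * (fun x => derive1 f (a * x + b)))); last first.
  by apply: times_derivableM; [exact: times_derivable_cst|exact: IH].
move=> x; rewrite [X in is_derive _ _ _ X]/=.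
have da : is_derive x 1 (fun x => a * x + b) a.
  have := is_deriveD (is_deriveZ a (is_derive_id x 1)) (is_derive_cst b x 1).
  by rewrite addr0 /GRing.scale/= mulr1.
have := @is_derive1_comp _ f (fun x => a * x + b) x _ _
  (derivable_is_derive df _) da.
by rewrite mulrC.
Qed.

(** Differentiating [expR (- x^-1)] produces inverse powers of [x]; the span of
    all [x ^- k * expR (- x^-1)] is closed under differentiation. *)
Definition flat_fun k (x : R) : R :=
  if 0 < x then x ^- k * expR (- x^-1) else 0.

Lemma flat_fun_ge0 k x : 0 <= flat_fun k x.
Proof.
rewrite /flat_fun; case: ifPn => // x0.
by rewrite mulr_ge0 ?expR_ge0// invr_ge0 exprn_ge0// ltW.
Qed.

(** The exponential series beats every power: [t ^ (k + 1) / (k + 1)! <= e ^ t]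
    at [t = 1 / x]. *)
Lemma flat_fun_le k x : 0 <= x -> flat_fun k x <= k.+1`!%:R * x.
Proof.
rewrite le_eqVlt => /predU1P[<-|x0]; first by rewrite /flat_fun ltxx mulr0.
rewrite /flat_fun x0 expRN ler_pdivrMr ?expR_gt0//.
have xk : 0 < x ^+ k by exact: exprn_gt0.
have fk : (0 : R) < k.+1`!%:R by rewrite ltr0n fact_gt0.
have := @expR_ge1Dxn _ x^-1 k; rewrite invr_ge0 => /(_ (ltW x0)) h.
have : x^-1 ^+ k.+1 / k.+1`!%:R <= expR x^-1 by apply: le_trans h; rewrite lerDr.
rewrite ler_pdivrMr// => /(ler_wpM2l (ltW x0)); rewrite exprS mulrA divff ?gt_eqF//.
by rewrite mul1r exprVn => /le_trans; apply; rewrite mulrA (mulrC _ x) mulrAC -mulrA.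
Qed.

(** At [0] the difference quotient is the next function of the family, which
    [flat_fun_le] shows to be [O(h)]. *)
Lemma flat_fun_derive k (x : R) :
  is_derive x 1 (flat_fun k) (flat_fun k.+2 x - k%:R * flat_fun k.+1 x).
Proof.
have [x0|x0|->] := ltgtP x 0.
- rewrite /flat_fun ltNge (ltW x0)/= mulr0 subr0.
  apply: (@near_eq_is_derive _ _ _ (cst 0)) => //.
  near=> y; rewrite /flat_fun ltNge ifF//; apply/negbTE; rewrite negbK ltW//.
  by near: y; exact: lt_nbhsl.
- rewrite /flat_fun x0.
  apply: (@near_eq_is_derive _ _ _
    ((fun y => (y ^+ k)^-1) * (expR \o (fun y => - y^-1)))).
    near=> y; rewrite /flat_fun ifT//.
    by near: y; exact: lt_nbhsr.
  have xn0 : x != 0 by rewrite gt_eqF.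
  have xkn0 : x ^+ k != 0 by rewrite expf_neq0.
  have d1 : is_derive x 1 (fun y : R => (y ^+ k)^-1)
      (- (x ^+ k) ^- 2 * (k%:R * x ^+ k.-1)).
    have dX : derivable (@GRing.exp R ^~ k) x 1 by exact: exprn_derivable.
    apply: DeriveDef; first exact: derivableV.
    by rewrite (deriveV (f := @GRing.exp R ^~ k))// exp_derive /GRing.scale/= mulr1.
  have d2 : is_derive x 1 (fun y : R => - y^-1) (x ^- 2).
    apply: DeriveDef; first by apply: derivableN; exact: derivableV.
    rewrite deriveN; last exact: derivableV.
    by rewrite (deriveV (f := id))// derive_id /GRing.scale/= mulr1 opprK.
  have d3 := @is_derive1_comp _ expR (fun y : R => - y^-1) x _ _
    (is_derive_expR (- x^-1)) d2.
  apply: is_derive_eq; rewrite /GRing.scale/=.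
  have -> : k%:R * x ^+ k.-1 = k%:R * x ^+ k / x :> R.
    by case: k {d1 xkn0} => [|k]; rewrite ?mul0r// exprSr mulrA mulfK.
  rewrite !exprS expr0 mulr1; field; exact/andP.
- rewrite /flat_fun ltxx mulr0 subr0.
  suff H : (fun h => h^-1 *: ((flat_fun k \o shift 0) (h *: 1) - flat_fun k 0))
      @ 0^' --> (0 : R).
    apply: DeriveDef; first by apply/cvg_ex; exists 0.
    exact: cvg_lim H.
  apply/cvgrPdist_le => e e0.
  near=> h.
  rewrite /flat_fun /= addr0 ltxx subr0 sub0r normrN /GRing.scale/= mulr1.
  case: ifPn => [h0|_]; last by rewrite mulr0 normr0 ltW.
  rewrite mulrA -invfM -exprS.
  have := @flat_fun_le k.+1 h (ltW h0); have := flat_fun_ge0 k.+1 h.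
  rewrite /flat_fun h0 => /ger0_norm -> /le_trans; apply.
  rewrite mulrC -ler_pdivlMr ?ltr0n ?fact_gt0//.
  rewrite -(gtr0_norm h0); near: h; apply: dnbhs0_le.
  by rewrite divr_gt0// ltr0n fact_gt0.
Unshelve. all: by end_near. Qed.

Lemma flat_fun_times_derivable n k : times_derivable n (flat_fun k).
Proof.
elim: n k => [//|n IH] k.
apply: (@times_derivableS _ _ (flat_fun k.+2 + cst (- k%:R) * flat_fun k.+1)).
  move=> x; rewrite [X in is_derive _ _ _ X](_ : _ =
    flat_fun k.+2 x - k%:R * flat_fun k.+1 x); first exact: flat_fun_derive.
  by rewrite !fctE mulNr.
by apply: times_derivableD => //; apply: times_derivableM => //;
  exact: times_derivable_cst.
Qed.

(** Rescaling the argument of [expR (- t^-1)] makes it tend to [1] for every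
    [t > 0], so these bumps increase to the indicator of [`]a, b[]. *)
Definition bump (a b : R) n (x : R) : R :=
  flat_fun 0 (n.+1%:R * (x - a)) * flat_fun 0 (n.+1%:R * (b - x)).

Lemma smooth_bump a b n : smooth (bump a b n).
Proof.
move=> m; have -> : bump a b n =
    (fun x => flat_fun 0 (n.+1%:R * x + (- (n.+1%:R * a)))) *
    (fun x => flat_fun 0 ((- n.+1%:R) * x + n.+1%:R * b)).
  by apply/funext => x; rewrite /bump !fctE; congr (flat_fun _ _ * flat_fun _ _);
    ring.
by apply: times_derivableM; apply: times_derivable_affine;
  exact: flat_fun_times_derivable.
Qed.

Lemma flat_fun0_le1 x : flat_fun 0 x <= 1.
Proof.
rewrite /flat_fun; case: ifPn => // x0; rewrite expr0 invr1 mul1r expR_le1.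
by rewrite oppr_le0 invr_ge0 ltW.
Qed.

Lemma bump_ge0 a b n x : 0 <= bump a b n x.
Proof. by rewrite mulr_ge0// flat_fun_ge0. Qed.

Lemma bump_le1 a b n x : bump a b n x <= 1.
Proof. by rewrite mulr_ile1 ?flat_fun_ge0 ?flat_fun0_le1. Qed.

Lemma bump_out a b n x : x <= a \/ b <= x -> bump a b n x = 0.
Proof.
rewrite /bump /flat_fun !pmulr_rgt0// !subr_gt0.
by move=> [h|h]; rewrite (ltNge _ x) (ltNge x) h/= ?mul0r ?mulr0.
Qed.

Lemma bump_cvg a b x : bump a b n x @[n --> \oo] --> (\1_(`]a, b[%classic) x : R).
Proof.
have flat (t : R) : 0 < t -> flat_fun 0 (n.+1%:R * t) @[n --> \oo] --> (1 : R).
  move=> t0; rewrite (_ : (fun n => _) =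
      (fun n => expR (- (n.+1%:R^-1 * t^-1)))); last first.
    by apply/funext => n; rewrite /flat_fun pmulr_rgt0// t0 expr0 invr1 mul1r invfM.
  have h0 : - (n.+1%:R^-1 * t^-1) @[n --> \oo] --> (0 : R).
    rewrite -[X in _ --> X]oppr0 -[X in - X](mul0r t^-1).
    by apply: cvgN; apply: cvgMr_tmp; exact: cvg_harmonic.
  rewrite -[X in _ --> X]expR0.
  by apply: (cvg_comp _ _ h0); exact: continuous_expR.
rewrite indicE; case: (boolP (x \in _)) => [|/negP]; rewrite inE /= in_itv/=.
  move=> /andP[ax xb]; rewrite -[X in _ --> X]mulr1.
  by apply: cvgM; apply: flat; rewrite subr_gt0.
move=> /negP; rewrite negb_and -!leNgt => /orP xab.
rewrite (_ : (fun n => _) = cst 0); first exact: cvg_cst.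
by apply/funext => n; rewrite bump_out.
Qed.

End Smooth.

(** * Integrals over a set of finite measure *)

Section Integration.
Context {R : realType}.
Local Notation mu := (@lebesgue_measure R).
Variables (A : set R).
Hypotheses (mA : measurable A) (finA : (mu A < +oo)%E).
Implicit Types (f g phi : R -> R).

Definition square_integrable g :=
  measurable_fun A g /\ mu.-integrable A (EFin \o (fun x => g x ^+ 2)).

Lemma integrable_le f g : measurable_fun A f ->
  mu.-integrable A (EFin \o g) -> (forall x, A x -> `|f x| <= g x) ->
  mu.-integrable A (EFin \o f).
Proof.
move=> mf ig fg; apply: le_integrable ig => //; first exact/measurable_EFinP.
by move=> x Ax /=; rewrite lee_fin (le_trans (fg _ Ax))// ler_norm.
Qed.

Lemma integrable_scale (c : R) g : mu.-integrable A (EFin \o g) ->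
  mu.-integrable A (EFin \o (fun x => c * g x)).
Proof. by move=> ig; have := @integrableZl _ _ _ mu _ mA c _ ig. Qed.

Lemma integrable_add f g : mu.-integrable A (EFin \o f) ->
  mu.-integrable A (EFin \o g) ->
  mu.-integrable A (EFin \o (fun x => f x + g x)).
Proof. by move=> fi gi; have := @integrableD _ _ _ mu _ mA _ _ fi gi. Qed.

Lemma integrable_cst (c : R) : mu.-integrable A (EFin \o cst c).
Proof.
by apply: measurable_bounded_integrable => //; exact: bounded_cst.
Qed.

Lemma integrable_bounded phi (K : R) : measurable_fun A phi ->
  (forall x, A x -> `|phi x| <= K) -> mu.-integrable A (EFin \o phi).
Proof. by move=> mp pK; apply: integrable_le (integrable_cst K) _. Qed.

Lemma integrable_mul_bounded g phi (K : R) : mu.-integrable A (EFin \o g) ->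
  measurable_fun A phi -> (forall x, A x -> `|phi x| <= K) ->
  mu.-integrable A (EFin \o (fun x => g x * phi x)).
Proof.
move=> ig mphi phiK.
have mg : measurable_fun A g by apply/measurable_EFinP; exact: measurable_int ig.
apply: (@integrable_le _ (fun x => K * `|g x|)).
- exact: measurable_funM.
- exact: integrable_scale (integrable_norm ig).
- by move=> x Ax; rewrite normrM mulrC ler_wpM2r// phiK.
Qed.

Lemma square_integrable_integrable g :
  square_integrable g -> mu.-integrable A (EFin \o g).
Proof.
move=> [mg ig]; apply: (@integrable_le _ (fun x => g x ^+ 2 + cst 1 x)) => //.
  exact: integrable_add ig (integrable_cst 1).
move=> x _ /=; have := sqr_ge0 (`|g x| - 1); rewrite sqrrB -normrX ger0_norm ?sqr_ge0//.
have := normr_ge0 (g x); nra.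
Qed.

Lemma Rintegral_cvg_dominated g phi (phi_ : nat -> R -> R) (K : R) :
  mu.-integrable A (EFin \o g) ->
  (forall n, measurable_fun A (phi_ n)) -> measurable_fun A phi ->
  (forall n x, A x -> `|phi_ n x| <= K) ->
  (forall x, A x -> phi_ n x @[n --> \oo] --> phi x) ->
  \int[mu]_(x in A) (g x * phi_ n x) @[n --> \oo] -->
    \int[mu]_(x in A) (g x * phi x).
Proof.
move=> ig mphi_ mphi phiK phicvg.
have mg : measurable_fun A g by apply/measurable_EFinP; exact: measurable_int ig.
have [|||||i1 _ cv] := @dominated_convergence _ _ _ mu A mA
  (fun n x => (g x * phi_ n x)%:E) (fun x => (g x * phi x)%:E)
  (fun x => (K * `|g x|)%:E).
- move=> n; apply/measurable_EFinP. exact: (measurable_funM mg (mphi_ n)).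
- by apply/measurable_EFinP; exact: measurable_funM.
- apply: aeW => x Ax; apply: cvg_EFin; first exact: nearW.
  by apply: cvgMl_tmp; exact: phicvg.
- exact: integrable_scale (integrable_norm ig).
- apply: aeW => x n Ax; rewrite lee_fin normrM mulrC ler_wpM2r//.
  exact: phiK.
apply: fine_cvg; rewrite fineK; first exact: cv.
exact: integrable_fin_num i1.
Qed.

(** The weighted arithmetic-geometric mean inequality, integrated; the free
    weight [t] plays the part of the optimisation in Cauchy-Schwarz. *)
Lemma norm_Rintegral_mul_le g phi (K t : R) : square_integrable g ->
  measurable_fun A phi -> (forall x, A x -> `|phi x| <= K) -> 0 < t ->
  `|\int[mu]_(x in A) (g x * phi x)| <=
    t / 2 * \int[mu]_(x in A) (g x ^+ 2) +
    (2 * t)^-1 * \int[mu]_(x in A) (phi x ^+ 2).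
Proof.
move=> sg mphi phiK t0; have [mg ig] := sg.
have ip : mu.-integrable A (EFin \o (fun x => phi x ^+ 2)).
  apply: (@integrable_bounded _ (K ^+ 2)); first exact: measurable_funX.
  by move=> x Ax; rewrite normrX lerXn2r ?nnegrE ?(le_trans _ (phiK x Ax))// phiK.
have igp : mu.-integrable A (EFin \o (fun x => g x * phi x)).
  exact: integrable_mul_bounded (square_integrable_integrable sg) mphi phiK.
rewrite -!RintegralZl//; rewrite -RintegralD//; last 2 first.
- exact: integrable_scale ig.
- exact: integrable_scale ip.
apply: le_trans (@le_normr_Rintegral _ _ _ mu A (fun x => g x * phi x) mA igp) _.
apply: le_Rintegral => //.
- exact: integrable_norm igp.
- by apply: integrable_add; apply: integrable_scale.
move=> x _; rewrite -subr_ge0.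
have -> : t / 2 * g x ^+ 2 + (2 * t)^-1 * phi x ^+ 2 - `|g x * phi x| =
    (2 * t)^-1 * (t * `|g x| - `|phi x|) ^+ 2.
  rewrite normrM -(real_normK (num_real (g x))) -(real_normK (num_real (phi x))); field.
  by rewrite gt_eqF.
by rewrite mulr_ge0 ?sqr_ge0// invr_ge0 mulr_ge0// ltW.
Qed.

End Integration.

(** * Averages and weak derivatives *)

Section WeakDerivative.
Context {R : realType}.
Local Notation mu := (@lebesgue_measure R).
Implicit Types (f g phi : R -> R) (a b c d x : R) (n : nat).

Lemma itv_finite (i : interval R) a b : [set` i] `<=` `[a, b] ->
  (mu [set` i] < +oo)%E.
Proof.
move=> iab; apply: (@le_lt_trans _ _ (mu `[a, b])).
  by apply: le_measure => //; rewrite inE.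
by rewrite lebesgue_measure_itv/=; case: ifP => _; rewrite ?ltry// -EFinB ltry.
Qed.

Lemma oo_finite a b : (mu `]a, b[ < +oo)%E.
Proof. by apply: (@itv_finite _ a b); exact: subset_itv_oo_cc. Qed.

Lemma norm_le_cvg (x_ : nat -> R) x (K : R) : x_ n @[n --> \oo] --> x ->
  (forall n, `|x_ n| <= K) -> `|x| <= K.
Proof.
move=> xx xK; rewrite -(cvg_lim (@Rhausdorff R) (cvg_norm xx)).
by apply: limr_le; [exact: cvgP (cvg_norm xx)|exact: nearW].
Qed.

Lemma measure_cc a b : a <= b -> mu `[a, b] = (b - a)%:E.
Proof.
rewrite le_eqVlt lebesgue_measure_itv/= lte_fin => /predU1P[->|->//].
by rewrite ltxx subrr.
Qed.

Lemma measure_oo a b : a <= b -> mu `]a, b[ = (b - a)%:E.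
Proof.
rewrite le_eqVlt lebesgue_measure_itv/= lte_fin => /predU1P[->|->//].
by rewrite ltxx subrr.
Qed.

Lemma bump_continuous a b n : continuous (bump a b n).
Proof.
move=> x; apply: differentiable_continuous; apply/derivable1_diffP.
by have [] := @smooth_bump R a b n 1.
Qed.

Lemma measurable_bump A a b n : measurable_fun A (bump a b n).
Proof.
by apply: measurable_funTS; apply: continuous_measurable_fun;
  exact: bump_continuous.
Qed.

Lemma bump_le_indic a b n x : bump a b n x <= (\1_(`[a, b]%classic) x : R).
Proof.
rewrite indicE; case: (boolP (x \in _)) => [_|/negP]; first exact: bump_le1.
rewrite inE /= in_itv/= => /negP; rewrite negb_and -!ltNge => /orP xab.
by rewrite bump_out//; case: xab => /ltW; [left|right].
Qed.

Lemma integrable_bump A a b n : measurable A ->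
  mu.-integrable A (EFin \o bump a b n).
Proof.
move=> mA; apply: (@integrableS _ _ _ mu setT) => //.
apply: (@integrable_le _ setT _ _ (\1_(`[a, b]%classic) : R -> R)) => //.
- exact: measurable_bump.
- exact: integrable_indic_itv.
- by move=> x _; rewrite ger0_norm ?bump_ge0 ?bump_le_indic.
Qed.

Lemma integrable_restrict A f : measurable A ->
  mu.-integrable A (EFin \o f) -> mu.-integrable setT (EFin \o (f \_ A)).
Proof.
by move=> mA ifA; rewrite -restrict_EFin; apply: (integrable_mkcond _ mA).1.
Qed.

Lemma Rintegral_support A f : (forall x, f x != 0 -> A x) ->
  \int[mu]_(x in A) f x = \int[mu]_x f x.
Proof.
move=> fA; rewrite Rintegral_mkcond; apply: eq_Rintegral => x _.
rewrite patchE; case: ifPn => // /negP; rewrite inE => Ax.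
by apply/esym/eqP; apply/negP => /negP /fA.
Qed.

Lemma Rintegral_mul_indic A D g : D `<=` A ->
  \int[mu]_(x in A) (g x * \1_D x) = \int[mu]_(x in D) g x.
Proof.
move=> DA; rewrite [RHS]Rintegral_mkcond Rintegral_mkcond.
apply: eq_Rintegral => x _; rewrite !patchE indicE.
case: (boolP (x \in D)) => [|_]; rewrite ?mulr1 ?mulr0 ?if_same// inE => /DA Ax.
by rewrite mem_set.
Qed.

Definition bump_mass a b n : R := \int[mu]_x bump a b n x.

Definition bump_primitive a b n (x : R) : R :=
  \int[mu]_(t in `]-oo, x]) bump a b n t.

Lemma bump_primitive_derive a b n x :
  is_derive x 1 (bump_primitive a b n) (bump a b n x).
Proof.
have [||//|df dfE] := @continuous_FTC1 R (bump a b n) -oo%O x (x + 1) _ _ _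
    (@bump_continuous a b n x).
- by rewrite ltrDl.
- exact: integrable_bump.
- exact: ltNyr.
by apply: DeriveDef; [exact: df|rewrite -derive1E; exact: dfE].
Qed.

Lemma bump_primitive_ge0 a b n x : 0 <= bump_primitive a b n x.
Proof. by apply: Rintegral_ge0 => t _; exact: bump_ge0. Qed.

Lemma bump_primitive_le a b n x : bump_primitive a b n x <= bump_mass a b n.
Proof.
rewrite /bump_primitive Rintegral_mkcond; apply: le_Rintegral => //.
- by apply: integrable_restrict => //; exact: integrable_bump.
- exact: integrable_bump.
- by move=> t _; rewrite patchE; case: ifP => // _; exact: bump_ge0.
Qed.

Lemma bump_primitive_left a b n x : x <= a -> bump_primitive a b n x = 0.
Proof.
move=> xa; rewrite /bump_primitive (@eq_Rintegral _ _ _ _ _ (cst 0)).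
  by rewrite Rintegral_cst// mul0r.
move=> t; rewrite inE /= in_itv/= => tx; apply: bump_out.
by left; exact: le_trans tx xa.
Qed.

Lemma bump_primitive_right a b n x : b <= x ->
  bump_primitive a b n x = bump_mass a b n.
Proof.
move=> bx; apply: Rintegral_support => t; rewrite /= in_itv/= => t0.
rewrite leNgt; apply/negP => xt; move/negP: t0; apply; apply/eqP.
by apply: bump_out; right; rewrite (le_trans bx)// ltW.
Qed.

Lemma bump_mass_le a b n : a <= b -> bump_mass a b n <= b - a.
Proof.
move=> ab; have -> : b - a = \int[mu]_x (\1_(`[a, b]%classic) x : R).
  rewrite /Rintegral integral_indic// setIT.
  by rewrite [X in fine X](_ : _ = (b - a)%:E)//; exact: measure_cc.
apply: le_Rintegral => //; first exact: integrable_bump.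
- exact: integrable_indic_itv.
- by move=> x _; exact: bump_le_indic.
Qed.

Lemma Rintegral_bump_cvg A g a b : measurable A -> `]a, b[ `<=` A ->
  mu.-integrable A (EFin \o g) ->
  \int[mu]_(x in A) (g x * bump a b n x) @[n --> \oo] -->
    \int[mu]_(x in `]a, b[) g x.
Proof.
move=> mA abA ig; rewrite -(Rintegral_mul_indic _ abA).
apply: (@Rintegral_cvg_dominated _ _ mA _ _ _ 1 ig).
- by move=> n; exact: measurable_bump.
- exact: measurable_indic.
- by move=> n x _; rewrite ger0_norm ?bump_ge0 ?bump_le1.
- by move=> x _; exact: bump_cvg.
Qed.

Lemma bump_mass_cvg a b : a <= b -> bump_mass a b n @[n --> \oo] --> b - a.
Proof.
move=> ab; have i1 : mu.-integrable `]a, b[ (EFin \o cst (1 : R)).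
  by apply: integrable_cst => //; exact: oo_finite.
have := @Rintegral_bump_cvg `]a, b[ (cst 1) a b _ _ i1.
rewrite Rintegral_cst// mul1r [X in fine X](_ : _ = (b - a)%:E); last first.
  exact: measure_oo.
move=> /(_ (measurable_itv _) (@subset_refl _ _)); apply: cvg_trans.
apply: near_eq_cvg; apply: nearW => n.
rewrite -[RHS](@Rintegral_support `]a, b[%classic).
  by apply: eq_Rintegral => x _; rewrite mul1r.
move=> x; rewrite /= in_itv/= => x0; apply/andP; split; rewrite ltNge;
  apply/negP => h; move/negP: x0; apply; apply/eqP; apply: bump_out; tauto.
Qed.

Lemma norm_cross_diff_le (x y p q s t : R) : 0 <= x -> x <= p -> p <= s ->
  0 <= y -> y <= q -> q <= t -> `|q * x - p * y| <= s * t.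
Proof.
move=> x0 xp ps y0 yq qt; rewrite ler_norml.
have p0 : 0 <= p by exact: le_trans xp.
have q0 : 0 <= q by exact: le_trans yq.
have le1 : q * x <= s * t by rewrite mulrC ler_pM// (le_trans xp).
have le2 : p * y <= s * t by rewrite ler_pM// (le_trans yq).
have ge1 : 0 <= q * x by exact: mulr_ge0.
have ge2 : 0 <= p * y by exact: mulr_ge0.
by apply/andP; split; lra.
Qed.

(** Each bump is weighted by the mass of the other one, so both terms have the
    same total mass and the primitive of their difference vanishes outside
    [[al, be]]. *)
Lemma test_function_bumps (l u al be a b c d : R) n :
  l < al -> be < u -> al <= a -> a < b -> b <= be -> al <= c -> c < d -> d <= be ->
  let phi x := bump_mass c d n * bump_primitive a b n x -
               bump_mass a b n * bump_primitive c d n x in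
  [/\ test_function `]l, u[ phi,
    derive1 phi = (fun x => bump_mass c d n * bump a b n x -
                            bump_mass a b n * bump c d n x) &
    forall x, `|phi x| <= (b - a) * (d - c) * (\1_(`[al, be]%classic) x : R)].
Proof.
move=> lal beu ala ab bbe alc cd dbe phi.
have dphi x : is_derive x 1 phi (bump_mass c d n * bump a b n x -
    bump_mass a b n * bump c d n x).
  by apply: is_deriveB; apply: is_deriveZ; exact: bump_primitive_derive.
have dphiE : derive1 phi = (fun x => bump_mass c d n * bump a b n x -
    bump_mass a b n * bump c d n x).
  by apply/funext => x; rewrite derive1E; have [] := dphi x.
have phi_out x : ~~ (al <= x <= be) -> phi x = 0.
  rewrite negb_and -!ltNge => /orP[xal|bex]; rewrite /phi.
    rewrite !bump_primitive_left ?mulr0 ?subrr ?ltW ?(lt_le_trans xal)//.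
  rewrite !bump_primitive_right ?(le_trans _ (ltW bex))//.
  by rewrite mulrC; exact: subrr.
have clphi : closure [set x | phi x != 0] `<=` `[al, be].
  rewrite [X in _ `<=` X](closure_id _).1; last exact: itv_closed.
  apply: closureS => x; rewrite /= in_itv/= => phix.
  by apply: contraNT phix => /phi_out ->.
split => //.
- split; last split.
  + apply: smooth_derivable => -[//|m].
    apply: (times_derivableS dphi).
    rewrite (_ : (fun _ => _) = cst (bump_mass c d n) * bump a b n +
      cst (- bump_mass a b n) * bump c d n); last first.
      by apply/funext => x; rewrite !fctE mulNr.
    apply: times_derivableD; apply: times_derivableM;
      by [exact: times_derivable_cst|exact: smooth_bump].
  + apply: subclosed_compact clphi; first exact: closed_closure.
    exact: segment_compact.
  + apply: subset_trans clphi _ => x; rewrite /= !in_itv/= => /andP[alx xbe].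
    by rewrite (lt_le_trans lal)//= (le_lt_trans xbe).
- move=> x; rewrite indicE; case: (boolP (x \in _)) => [_|]; last first.
    by rewrite notin_setE /= in_itv/= => /negP/phi_out ->; rewrite normr0 mulr0.
  have h1 := bump_primitive_ge0 a b n x; have h2 := bump_primitive_ge0 c d n x.
  have h3 := bump_primitive_le a b n x; have h4 := bump_primitive_le c d n x.
  have h5 := bump_mass_le n (ltW ab); have h6 := bump_mass_le n (ltW cd).
  rewrite mulr1; exact: (norm_cross_diff_le h1 h3 h5 h2 h4 h6).
Qed.

(** Testing the weak derivative against the bumps and letting them tend to the
    indicators of the two intervals: the averages of [g] over two intervals
    of [[al, be]] differ by at most the integral of [`|g'|] over [[al, be]], here
    bounded by the weighted mean inequality and multiplied by both lengths. *)
Lemma weak_derivative_average_diff (l u al be a b c d tau : R) g g' :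
  l < al -> be < u -> al <= a -> a < b -> b <= be -> al <= c -> c < d -> d <= be ->
  0 < tau -> square_integrable `]l, u[ g -> square_integrable `]l, u[ g' ->
  weak_derivative `]l, u[ g g' ->
  `|(d - c) * \int[mu]_(x in `]a, b[) g x - (b - a) * \int[mu]_(x in `]c, d[) g x|
  <= (b - a) * (d - c) *
     (tau / 2 * \int[mu]_(x in `]l, u[) (g' x ^+ 2) + (2 * tau)^-1 * (be - al)).
Proof.
move=> lal beu ala ab bbe alc cd dbe tau0 sg sg' wg.
have mA : measurable (`]l, u[%classic : set R) by [].
have fA := oo_finite l u.
have ig := square_integrable_integrable mA fA sg.
have abA : `]a, b[ `<=` `]l, u[.
  apply: subset_itv; rewrite bnd_simp; first by rewrite (le_trans (ltW lal)).
  by rewrite (le_trans bbe)// ltW.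
have cdA : `]c, d[ `<=` `]l, u[.
  apply: subset_itv; rewrite bnd_simp; first by rewrite (le_trans (ltW lal)).
  by rewrite (le_trans dbe)// ltW.
have cv : (bump_mass c d n * \int[mu]_(x in `]l, u[) (g x * bump a b n x) -
    bump_mass a b n * \int[mu]_(x in `]l, u[) (g x * bump c d n x))
    @[n --> \oo] --> (d - c) * \int[mu]_(x in `]a, b[) g x -
      (b - a) * \int[mu]_(x in `]c, d[) g x.
  apply: cvgB; apply: cvgM.
  - exact: bump_mass_cvg (ltW cd).
  - exact: (Rintegral_bump_cvg mA abA ig).
  - exact: bump_mass_cvg (ltW ab).
  - exact: (Rintegral_bump_cvg mA cdA ig).
apply: (norm_le_cvg cv) => n; set P := (b - a) * (d - c).
have P0 : 0 < P by rewrite mulr_gt0// subr_gt0.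
have [tphi dphi phiP] :=
  test_function_bumps n lal beu ala ab bbe alc cd dbe.
set phi := (fun x => _) in tphi dphi phiP.
have alA : `[al, be] `<=` `]l, u[ by apply: subset_itv; rewrite bnd_simp.
have ibump p q : mu.-integrable `]l, u[ (EFin \o (fun x => g x * bump p q n x)).
  apply: (@integrable_mul_bounded _ _ mA _ _ 1 ig); first exact: measurable_bump.
  by move=> x _; rewrite ger0_norm ?bump_ge0 ?bump_le1.
have -> : bump_mass c d n * \int[mu]_(x in `]l, u[) (g x * bump a b n x) -
    bump_mass a b n * \int[mu]_(x in `]l, u[) (g x * bump c d n x) =
    - \int[mu]_(x in `]l, u[) (g' x * phi x).
  rewrite -(wg _ tphi) dphi.
  rewrite -RintegralZl; [|exact: mA|exact: ibump].
  rewrite -RintegralZl; [|exact: mA|exact: ibump].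
  rewrite -RintegralB; [|exact: mA| |]; last 2 first.
  - exact: integrable_scale.
  - exact: integrable_scale.
  apply: eq_Rintegral => x _; rewrite [RHS]mulrBr.
  by congr (_ - _); exact: mulrCA.
have mphi : measurable_fun `]l, u[ phi.
  apply: measurable_funTS; apply: continuous_measurable_fun => x.
  apply: differentiable_continuous; apply/derivable1_diffP.
  by have [+ _] := tphi => /(_ 0%N x).
have phiK x : `]l, u[%classic x -> `|phi x| <= P.
  move=> _; apply: le_trans (phiP x) _.
  apply: ler_piMr; first exact: ltW.
  by rewrite indicE; case: (_ \in _).
rewrite normrN.
apply: le_trans (norm_Rintegral_mul_le mA fA sg' mphi phiK (mulr_gt0 tau0 P0)) _.
have le_phi : \int[mu]_(x in `]l, u[) (phi x ^+ 2) <= P ^+ 2 * (be - al).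
  have albe : al <= be by rewrite (le_trans ala)// (le_trans (ltW ab)).
  have -> : P ^+ 2 * (be - al) =
      \int[mu]_(x in `]l, u[) (P ^+ 2 * \1_(`[al, be]%classic) x).
    rewrite (@Rintegral_mul_indic `]l, u[ `[al, be] (cst (P ^+ 2)))//.
    by rewrite Rintegral_cst// [X in fine X](_ : _ = (be - al)%:E)//; exact: measure_cc.
  apply: le_Rintegral => //.
  - apply: (@integrable_bounded _ _ mA fA _ (P ^+ 2)).
      exact: measurable_funX.
    by move=> x /phiK; rewrite normrX => h; rewrite lerXn2r// nnegrE ltW.
  - apply: integrable_scale => //; apply: integrableS (integrable_indic_itv _ _ _ _) => //.
  - move=> x _; rewrite -(real_normK (num_real (phi x))).
    have /(lerXn2r 2) := phiP x; rewrite !nnegrE => /(_ (normr_ge0 _)).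
    rewrite indicE -/P; case: (x \in _); rewrite ?mulr1 ?mulr0 ?expr0n/=.
      by apply; exact: ltW.
    by apply.
rewrite mulrDr lerD//.
  by rewrite (mulrC tau) -!mulrA.
apply: le_trans (ler_wpM2l _ le_phi) _.
  by rewrite invr_ge0 mulr_ge0// mulr_ge0 ?ltW.
rewrite le_eqVlt; apply/orP; left; apply/eqP; field.
by rewrite !gt_eqF.
Qed.

End WeakDerivative.

(** * Lipschitz functions with small square norm *)

Section SquareNorm.
Context {R : realType}.
Local Notation mu := (@lebesgue_measure R).
Implicit Types (A : set R) (f g F G : R -> R).

Lemma L2norm_sqr A f :
  (L2norm A f ^+ 2 = \int[mu]_(x in A) (f x ^+ 2)%:E)%E.
Proof.
have two0 : (2 : R) != 0 by [].
have E (y : \bar R) : (0 <= y)%E -> (y ^+ 2 = y `^ 2)%E.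
  case: y => [y||//]; rewrite ?lee_fin => y0; last by rewrite poweRyr.
  by rewrite poweR_EFin powR_mulrn// -EFin_expe.
rewrite E ?Lnorm_ge0// poweR_Lnorm// [RHS]integral_mkcond.
apply: eq_integral => x _.
rewrite (_ : `| _ |%E = `|(f \_ A) x|%:E)// poweR_EFin powR_mulrn// real_normK ?num_real//.
by rewrite !patchE; case: ifP => //; rewrite expr0n.
Qed.

(** A Lipschitz function exceeding [K] at [w] exceeds [K / 2] on an interval
    whose length depends only on [K], on the Lipschitz constant and on the
    distance from [w] to the ends, and this forces a definite norm. *)
Lemma L2norm_lipschitz_le (lo hi w L K : R) : lo < w -> w < hi -> 0 < L -> 0 < K ->
  exists2 delta : R, 0 < delta & forall F G,
    (forall x y, `|F x - F y| <= L * `|x - y|) ->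
    measurable_fun setT G -> (forall x, `|F x| <= G x) ->
    (L2norm `]lo, hi[ G < delta%:E)%E -> `|F w| <= K.
Proof.
move=> low whi L0 K0.
pose rho := Num.min (Num.min (w - lo) (hi - w)) (K / (2 * L)).
have rho0 : 0 < rho.
  by rewrite !lt_min !subr_gt0 low whi/= divr_gt0// mulr_gt0.
have rlo : rho <= w - lo by rewrite !ge_min lexx.
have rhi : rho <= hi - w by rewrite !ge_min lexx orbT.
have rL : L * rho <= K / 2.
  have : rho <= K / (2 * L) by rewrite !ge_min lexx orbT.
  move=> /(ler_wpM2l (ltW L0)) /le_trans; apply.
  by rewrite le_eqVlt; apply/orP; left; apply/eqP; field; rewrite gt_eqF.
pose m := (K / 2) ^+ 2 * (2 * rho).
have m0 : 0 < m by rewrite mulr_gt0 ?exprn_gt0 ?mulr_gt0// invr_gt0.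
exists (Num.sqrt m); first by rewrite sqrtr_gt0.
move=> F G FL mG FG; rewrite leNgt; apply: contraTN => KF.
rewrite -leNgt.
have IA : `]w - rho, w + rho[ `<=` `]lo, hi[.
  by apply: subset_itv; rewrite bnd_simp; lra.
have : (m%:E <= L2norm `]lo, hi[ G ^+ 2)%E.
  rewrite L2norm_sqr.
  have -> : m%:E = (\int[mu]_(x in `](w - rho)%R, (w + rho)%R[) (cst ((K / 2) ^+ 2)%:E x))%E.
    rewrite integral_cst// [X in (_ * X)%E](_ : _ = (2 * rho)%:E) -?EFinM//.
    have -> : 2 * rho = w + rho - (w - rho) by ring.
    by apply: measure_oo; lra.
  apply: (@le_trans _ _ (\int[mu]_(x in `](w - rho)%R, (w + rho)%R[) (G x ^+ 2)%:E)%E).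
    apply: ge0_le_integral => //.
    - by move=> x _; rewrite lee_fin sqr_ge0.
    - by apply/measurable_EFinP; apply: measurable_funX; exact: measurable_funTS.
    move=> x; rewrite /= in_itv/= => /andP[xl xr].
    rewrite lee_fin lerXn2r ?nnegrE ?divr_ge0 ?(ltW K0)//.
      exact: le_trans (normr_ge0 _) (FG x).
    apply: le_trans (FG x).
    have := FL w x; have : `|w - x| < rho by rewrite ltr_norml; lra.
    move=> /ltW /(ler_wpM2l (ltW L0)) h1 h2.
    have := ler_normB (F w - F x) (- F x) ; rewrite opprK subrK normrN; lra.
  apply: ge0_subset_integral => //.
  - by apply/measurable_EFinP; apply: measurable_funX; exact: measurable_funTS.
  - by move=> x _; rewrite lee_fin sqr_ge0.
have : (0 <= L2norm `]lo, hi[ G)%E by exact: Lnorm_ge0.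
case: (L2norm _ _) => [y||//]; rewrite ?leey// -EFin_expe !lee_fin => y0 my.
by rewrite -(ger0_norm y0) -sqrtr_sqr ler_wsqrtr.
Qed.

End SquareNorm.

(** * Iterated signs and difference quotients *)

Section IteratedSign.
Context {R : realType}.

(** The cubic with fixed points [-1], [0], [1] for which [1] and [-1] attract:
    its iterates converge to the sign function on [[-1, 1]]. *)
Definition sign_step (x : R) : R := (3 * x - x ^+ 3) / 2.

(** Iterates from [y > 0] stay above [y], and
    [1 - sign_step z = (1 - z) ^+ 2 * (2 + z) / 2], so the distance to [1] is
    multiplied by at most [1 - y / 2] at each step. *)
Lemma iter_sign_step_cvg (x : R) : `|x| <= 1 ->
  (forall n, `|iter n sign_step x| <= 1) /\
  iter n sign_step x @[n --> \oo] --> Num.sg x.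
Proof.
have pos (y : R) : 0 < y -> y <= 1 -> forall n,
    y <= iter n sign_step y <= 1 /\
    1 - iter n sign_step y <= (1 - y / 2) ^+ n.
  move=> y0 y1; elim=> [|n [/andP[h1 h2] h3]] /=.
    by rewrite lexx y1 expr0; split => //; lra.
  move: (iter n _ _) h1 h2 h3 => z h1 h2 h3.
  have e0 : 0 <= (1 - y / 2) ^+ n by rewrite exprn_ge0//; lra.
  rewrite exprS /sign_step; set e := _ ^+ n in h3 e0 *.
  have i1 : (3 * z - z ^+ 3) / 2 - z = z * (1 - z) * (1 + z) / 2 by field.
  have i2 : 1 - (3 * z - z ^+ 3) / 2 = (1 - z) * ((1 - z) * (2 + z) / 2) by field.
  have j1 : 0 <= z * (1 - z) * (1 + z) by rewrite !mulr_ge0//; lra.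
  have j2 : 0 <= (1 - z) * ((1 - z) * (2 + z) / 2).
    by rewrite !mulr_ge0//; lra.
  split; first by apply/andP; split; lra.
  rewrite i2 mulrC; apply: ler_pM; [by rewrite !mulr_ge0//; lra|lra| |exact: h3].
  have : 0 <= z * z by exact: sqr_ge0.
  by lra.
have posc (y : R) : 0 < y -> y <= 1 ->
    iter n sign_step y @[n --> \oo] --> (1 : R).
  move=> y0 y1; have g0 : (1 - y / 2) ^+ n @[n --> \oo] --> (0 : R).
    by apply: cvg_expr; rewrite ger0_norm; lra.
  apply: (@squeeze_cvgr _ _ _ _ (fun n => 1 - (1 - y / 2) ^+ n) (cst 1)).
  - by apply: nearW => n; have [/andP[_ h2] h3] := pos y y0 y1 n; apply/andP; split => //; lra.
  - by rewrite -[X in _ --> X]subr0; apply: cvgB => //; exact: cvg_cst.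
  - exact: cvg_cst.
have odd (y : R) n : iter n sign_step (- y) = - iter n sign_step y.
  by elim: n => //= n ->; rewrite /sign_step; field.
have [x0|x0|->] := ltgtP x 0 => x1.
- have y0 : 0 < - x by rewrite oppr_gt0.
  have y1 : - x <= 1 by move: x1; rewrite ltr0_norm.
  split.
    move=> n; rewrite -(opprK x) odd normrN.
    by have [/andP[? ?] _] := pos _ y0 y1 n; rewrite ger0_norm//; lra.
  rewrite ltr0_sg// -(opprK x); under eq_fun do rewrite odd.
  by apply: cvgN; exact: posc.
- have y1 : x <= 1 by move: x1; rewrite gtr0_norm.
  split; last by rewrite gtr0_sg//; exact: posc.
  by move=> n; have [/andP[? ?] _] := pos _ x0 y1 n; rewrite ger0_norm//; lra.
- have z n : iter n sign_step 0 = 0.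
    by elim: n => //= n ->; rewrite /sign_step; ring.
  split=> [n|]; first by rewrite z normr0.
  by rewrite sgr0; under eq_fun do rewrite z; exact: cvg_cst.
Qed.

Lemma bounded_derive_lipschitz (f f' : R -> R) (K : R) :
  (forall x : R, is_derive x 1 f (f' x)) -> (forall x, `|f' x| <= K) ->
  forall x y, `|f x - f y| <= K * `|x - y|.
Proof.
move=> df fK.
have main x y : x < y -> `|f x - f y| <= K * `|x - y|.
  move=> xy; have [|c _ fc] := @MVT _ f f' x y xy (fun t _ => df t).
    apply: continuous_subspaceT => t; apply: differentiable_continuous.
    by apply/derivable1_diffP; have [] := df t.
  by rewrite distrC fc normrM (distrC x) ler_wpM2r.
move=> x y; have [|yx|->] := ltgtP x y; first exact: main.
  by rewrite distrC (distrC x); exact: main.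
by rewrite !subrr normr0 mulr0.
Qed.

Lemma derive_scale_arg (f : R -> R) (df z w : R) :
  is_derive (w * z) 1 f df -> is_derive w 1 (fun t => f (t * z)) (df * z).
Proof.
move=> dfx; have dz : is_derive w 1 (fun t => t * z) z.
  have := is_deriveZ z (is_derive_id w 1); rewrite /GRing.scale/= mulr1.
  by rewrite (_ : _ \*: _ = (fun t => t * z))//; apply/funext => t; rewrite mulrC.
by have := @is_derive1_comp _ f (fun t => t * z) w _ _ dfx dz.
Qed.

Lemma difference_quotient_cvg (f : R -> R) (w df rho : R) : 0 < rho ->
  is_derive w 1 f df ->
  (rho / n.+1%:R)^-1 * (f (rho / n.+1%:R + w) - f w) @[n --> \oo] --> df.
Proof.
move=> rho0 [fd <-].
have h0 : rho / n.+1%:R @[n --> \oo] --> 0^'.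
  have hc : rho / n.+1%:R @[n --> \oo] --> 0.
    by rewrite -(mulr0 rho); apply: cvgMl_tmp; exact: cvg_harmonic.
  move=> P /= [e /= e0 eP].
  have /cvgrPdist_lt/(_ e e0) := hc; apply: filterS => n; rewrite sub0r normrN => hn.
  apply: eP => /=; first by rewrite sub0r normrN.
  by rewrite mulf_neq0 ?gt_eqF ?invr_gt0.
apply: cvg_trans (cvg_comp _ _ h0 fd); apply: near_eq_cvg; apply: nearW => n.
by rewrite /= /GRing.scale/= mulr1.
Qed.

End IteratedSign.

(** * Functions whose pairing is controlled by a frequency band *)

Section Controlled.
Context {R : realType}.
Local Notation mu := (@lebesgue_measure R).
Variables (r lo hi B : R).
Hypotheses (r0 : 0 < r) (lohi : lo < hi) (B0 : 0 < B).
Local Notation A := (`](- r), r[%classic : set R).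
Implicit Types (g phi psi : R -> R) (w z K : R) (p : {poly R}).

Let mA : measurable A. Proof. by []. Qed.
Let fA : (mu A < +oo)%E. Proof. exact: oo_finite. Qed.

Definition cos_transform g w : R := \int[mu]_(z in A) (g z * cos (w * z)).
Definition sin_transform g w : R := \int[mu]_(z in A) (g z * sin (w * z)).

Definition spectral_norm g : \bar R :=
  L2norm `]lo, hi[ (fun w =>
    Num.sqrt (cos_transform g w ^+ 2 + sin_transform g w ^+ 2)).

Definition in_L2_ball g :=
  square_integrable A g /\ \int[mu]_(z in A) (g z ^+ 2) <= B.

(** Pairing against [phi] is small, uniformly over the ball, once the
    transform of [g] is small on the band: this is the quantitative form of
    [phi] being a limit of frequencies of the band. *)
Definition controlled phi :=
  [/\ measurable_fun A phi,
      exists K, forall z, A z -> `|phi z| <= K &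
      forall kappa, 0 < kappa -> exists2 delta, 0 < delta &
        forall g, in_L2_ball g -> (spectral_norm g < delta%:E)%E ->
          `|\int[mu]_(z in A) (g z * phi z)| <= kappa].

Lemma integrable_ball_mul g phi K : in_L2_ball g -> measurable_fun A phi ->
  (forall z, A z -> `|phi z| <= K) ->
  mu.-integrable A (EFin \o (fun z => g z * phi z)).
Proof.
move=> [sg _]; apply: (integrable_mul_bounded mA).
exact: (square_integrable_integrable mA fA sg).
Qed.

(** The threshold [delta] depends on the test function but not on [g], so it
    survives limits that are uniform over the ball; dominated convergence of
    the test functions in square mean gives such a limit. *)
Lemma controlled_lim phi (phi_ : nat -> R -> R) K :
  (forall n, controlled (phi_ n)) -> measurable_fun A phi ->
  (forall n z, A z -> `|phi_ n z| <= K) ->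
  (forall z, A z -> phi_ n z @[n --> \oo] --> phi z) ->
  controlled phi.
Proof.
move=> cphi_ mphi phi_K cvphi.
have mphi_ n : measurable_fun A (phi_ n) by case: (cphi_ n).
have phiK z : A z -> `|phi z| <= K.
  by move=> Az; apply: norm_le_cvg (cvphi _ Az) _ => n; exact: phi_K.
split => //; first by exists K.
move=> kappa k0.
have dK n z : A z -> `|phi z - phi_ n z| <= K + K.
  by move=> Az; rewrite (le_trans (ler_normB _ _))// lerD ?phiK ?phi_K.
have md n : measurable_fun A (fun z => phi z - phi_ n z).
  exact: measurable_funB.
have cv2 : \int[mu]_(z in A) ((phi z - phi_ n z) ^+ 2) @[n --> \oo] --> (0 : R).
  have -> : (0 : R) = \int[mu]_(z in A) (cst 1 z * cst 0 z).
    rewrite (@eq_Rintegral _ _ _ mu A (cst 0)); last by move=> z _; rewrite mulr0.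
    by rewrite Rintegral_cst// mul0r.
  rewrite (_ : (fun n => _) =
      (fun n => \int[mu]_(z in A) (cst 1 z * (phi z - phi_ n z) ^+ 2))); last first.
    by apply/funext => n; apply: eq_Rintegral => z _; rewrite mul1r.
  apply: (@Rintegral_cvg_dominated _ _ mA (cst 1) (cst 0) _ ((K + K) ^+ 2)).
  - exact: integrable_cst.
  - by move=> n; exact: measurable_funX.
  - exact: measurable_cst.
  - move=> n z Az; rewrite normrX lerXn2r ?nnegrE ?dK//.
    exact: le_trans (normr_ge0 _) (dK n z Az).
  - move=> z Az; rewrite [X in _ --> X](_ : _ = (phi z - phi z) ^+ 2); last first.
      by rewrite subrr expr0n.
    by apply: cvgM; apply: cvgB; by [exact: cvg_cst|exact: cvphi].
(* With this weight, [t / 2 * B = kappa / 4]. *)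
pose t := kappa / (2 * B).
have t0 : 0 < t by rewrite divr_gt0// mulr_gt0.
have tk : 0 < t * kappa / 2 by rewrite divr_gt0// mulr_gt0.
move: cv2 => /cvgrPdist_le /(_ _ tk)[n _ /(_ n (leqnn n))].
rewrite sub0r normrN ger0_norm; last first.
  by apply: Rintegral_ge0 => z _; exact: sqr_ge0.
move=> small.
have [_ _ /(_ (kappa / 2))] := cphi_ n; rewrite divr_gt0// => /(_ isT)[d d0 hd].
exists d => // g gB gd; have := hd g gB gd.
have -> : \int[mu]_(z in A) (g z * phi z) =
    \int[mu]_(z in A) (g z * phi_ n z) +
    \int[mu]_(z in A) (g z * (phi z - phi_ n z)).
  rewrite -RintegralD//; first by apply: eq_Rintegral => z _; ring.
  - exact: integrable_ball_mul gB (mphi_ n) (phi_K n).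
  - exact: integrable_ball_mul gB (md n) (dK n).
have := norm_Rintegral_mul_le mA fA gB.1 (md n) (dK n) t0.
move=> h1 h2; apply: (le_trans (ler_normD _ _)).
have e1 : t / 2 * \int[mu]_(z in A) (g z ^+ 2) <= kappa / 4.
  have -> : kappa / 4 = t / 2 * B by rewrite /t; field; rewrite gt_eqF.
  by apply: ler_wpM2l gB.2; rewrite divr_ge0// ltW.
have e2 : (2 * t)^-1 * \int[mu]_(z in A) ((phi z - phi_ n z) ^+ 2) <= kappa / 4.
  have -> : kappa / 4 = (2 * t)^-1 * (t * kappa / 2) by field; rewrite gt_eqF.
  by apply: ler_wpM2l small; rewrite invr_ge0 mulr_ge0// ltW.
lra.
Qed.

Lemma controlled_combination (a b : R) phi psi : controlled phi -> controlled psi ->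
  controlled (fun z => a * phi z + b * psi z).
Proof.
move=> [mphi [K phiK] cphi] [mpsi [L psiL] cpsi].
have bound z : A z -> `|a * phi z + b * psi z| <= `|a| * K + `|b| * L.
  move=> Az; rewrite (le_trans (ler_normD _ _))// !normrM.
  by rewrite lerD// ler_wpM2l// ?phiK ?psiL.
split.
- by apply: measurable_funD; exact: measurable_funM.
- by eexists; exact: bound.
move=> kappa k0; pose c := `|a| + `|b| + 1.
have c0 : 0 < c by rewrite ltr_wpDl.
have kc0 : 0 < kappa / c by rewrite divr_gt0.
have [d1 d10 h1] := cphi _ kc0; have [d2 d20 h2] := cpsi _ kc0.
exists (Num.min d1 d2); first by rewrite lt_min d10.
move=> g gB; rewrite EFin_min lt_min => /andP[gd1 gd2].
have {}h1 := h1 g gB gd1; have {}h2 := h2 g gB gd2.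
have -> : \int[mu]_(z in A) (g z * (a * phi z + b * psi z)) =
    a * \int[mu]_(z in A) (g z * phi z) + b * \int[mu]_(z in A) (g z * psi z).
  have i1 := integrable_ball_mul gB mphi phiK.
  have i2 := integrable_ball_mul gB mpsi psiL.
  rewrite -!RintegralZl// -RintegralD//.
  - by apply: eq_Rintegral => z _; ring.
  - exact: integrable_scale.
  - exact: integrable_scale.
rewrite (le_trans (ler_normD _ _))// !normrM.
have -> : kappa = c * (kappa / c) by field; rewrite gt_eqF.
move: (kappa / c) kc0 h1 h2 => q q0 h1 h2; rewrite /c.
have := ler_wpM2l (normr_ge0 a) h1; have := ler_wpM2l (normr_ge0 b) h2.
lra.
Qed.

Lemma Rintegral_mul_diff_le g phi psi (e : R) : in_L2_ball g ->
  measurable_fun A phi -> measurable_fun A psi ->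
  (forall z, A z -> `|phi z| <= 1) -> (forall z, A z -> `|psi z| <= 1) ->
  (forall z, A z -> `|phi z - psi z| <= e) -> 0 <= e ->
  `|\int[mu]_(z in A) (g z * phi z) - \int[mu]_(z in A) (g z * psi z)| <=
    e * (B + 2 * r).
Proof.
move=> gB mphi mpsi phi1 psi1 de e0; have [sg gB2] := gB.
have i1 := integrable_ball_mul gB mphi phi1.
have i2 := integrable_ball_mul gB mpsi psi1.
have i3 := integrable_ball_mul gB (measurable_funB mphi mpsi) de.
rewrite -RintegralB//.
rewrite (@eq_Rintegral _ _ _ mu A (fun z => g z * (phi \- psi) z)); last first.
  by move=> z _ /=; ring.
apply: le_trans (@le_normr_Rintegral _ _ _ mu A (fun z => g z * (phi \- psi) z) mA i3) _.
have ig2 := integrable_add mA sg.2 (integrable_cst mA fA 1).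
apply: (@le_trans _ _ (\int[mu]_(z in A) (e * (g z ^+ 2 + cst 1 z)))).
  apply: le_Rintegral => //; first exact: integrable_norm i3.
    exact: integrable_scale.
  move=> z Az; rewrite normrM mulrC ler_pM// ?de//=.
  have := sqr_ge0 (`|g z| - 1); rewrite -(real_normK (num_real (g z))).
  by have := normr_ge0 (g z); nra.
rewrite RintegralZl// ler_wpM2l// RintegralD//; last 2 first.
- exact: sg.2.
- exact: integrable_cst.
rewrite lerD// Rintegral_cst// mul1r [X in fine X](_ : _ = (2 * r)%:E)//.
have -> : 2 * r = r - - r by ring.
apply: measure_oo; rewrite (le_trans _ (ltW r0))// oppr_le0; exact: ltW.
Qed.

Let L := (B + 2 * r) * r.
Let L0 : 0 < L. Proof. by rewrite !mulr_gt0// addr_gt0// mulr_gt0. Qed.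

Lemma transform_lipschitz g (f : R -> R) : in_L2_ball g -> continuous f ->
  (forall x, `|f x| <= 1) -> (forall x y, `|f x - f y| <= 1 * `|x - y|) ->
  forall v w, `|\int[mu]_(z in A) (g z * f (v * z)) -
                \int[mu]_(z in A) (g z * f (w * z))| <= L * `|v - w|.
Proof.
move=> gB cf f1 fL v w.
have mf t : measurable_fun A (fun z => f (t * z)).
  apply: measurable_funTS; apply: continuous_measurable_fun => z.
  by apply: continuous_comp; [exact: mulrl_continuous|exact: cf].
have := @Rintegral_mul_diff_le g (fun z => f (v * z)) (fun z => f (w * z))
  (r * `|v - w|) gB (mf v) (mf w).
rewrite (_ : L * _ = r * `|v - w| * (B + 2 * r)); last by rewrite /L; ring.
apply => //.
- move=> z; rewrite /= in_itv/= -ltr_norml => /ltW zr.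
  by rewrite (le_trans (fL _ _))// mul1r -mulrBl normrM mulrC ler_wpM2r.
- by rewrite mulr_ge0// ltW.
Qed.

Lemma cos_lipschitz (x y : R) : `|cos x - cos y| <= 1 * `|x - y|.
Proof.
apply: (@bounded_derive_lipschitz _ cos (fun t => - sin t)) => t.
by rewrite normrN sin_max.
Qed.

Lemma sin_lipschitz (x y : R) : `|sin x - sin y| <= 1 * `|x - y|.
Proof. by apply: (@bounded_derive_lipschitz _ sin cos) => t; exact: cos_max. Qed.

Lemma lipschitz_continuous (f : R -> R) (K : R) :
  (forall x y, `|f x - f y| <= K * `|x - y|) -> continuous f.
Proof.
move=> fK x; apply/cvgrPdist_lt => e e0.
have K1 : 0 < `|K| + 1 by rewrite ltr_wpDl.
near=> y; apply: le_lt_trans (fK x y) _.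
apply: (@le_lt_trans _ _ ((`|K| + 1) * `|x - y|)).
  by rewrite ler_wpM2r// (le_trans (ler_norm _))// lerDl.
rewrite -ltr_pdivlMl//; near: y.
by apply: cvgr_dist_lt; [exact: cvg_id|rewrite mulr_gt0// invr_gt0].
Unshelve. all: by end_near. Qed.

Lemma measurable_trig (f : R -> R) k w : continuous f ->
  measurable_fun A (fun z => z ^+ k * f (w * z)).
Proof.
move=> cf; apply: measurable_funM; first exact: exprn_measurable.
apply: measurable_funTS; apply: continuous_measurable_fun => z.
by apply: continuous_comp; [exact: mulrl_continuous|exact: cf].
Qed.

(** The transforms of the functions of the ball share one Lipschitz constant,
    so smallness in square mean on the band gives smallness at each of its
    points. *)
Lemma controlled_band w : lo < w -> w < hi ->
  controlled (fun z => cos (w * z)) /\ controlled (fun z => sin (w * z)).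
Proof.
move=> low whi.
have mG g : in_L2_ball g -> measurable_fun setT (fun w =>
    Num.sqrt (cos_transform g w ^+ 2 + sin_transform g w ^+ 2)).
  move=> gB; apply: continuous_measurable_fun => v.
  have cc : continuous (cos_transform g).
    apply: (@lipschitz_continuous _ L); apply: transform_lipschitz => //.
    - exact: continuous_cos.
    - exact: cos_max.
    - exact: cos_lipschitz.
  have cs : continuous (sin_transform g).
    apply: (@lipschitz_continuous _ L); apply: transform_lipschitz => //.
    - exact: continuous_sin.
    - exact: sin_max.
    - exact: sin_lipschitz.
  apply: (@continuous_comp _ _ _ (fun w => cos_transform g w ^+ 2 +
    sin_transform g w ^+ 2) Num.sqrt); last exact: sqrt_continuous.
  have sq (h : R -> R) : continuous h -> continuous (fun t => h t ^+ 2).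
    move=> ch t; apply: (@continuous_comp _ _ _ h (fun s => s ^+ 2)).
      exact: ch.
    exact: exprn_continuous.
  by apply: cvgD; [exact: (sq _ cc)|exact: (sq _ cs)].
have aux (f : R -> R) : continuous f -> (forall x, `|f x| <= 1) ->
    (forall x y, `|f x - f y| <= 1 * `|x - y|) ->
    (forall g v, `|\int[mu]_(z in A) (g z * f (v * z))| <=
      Num.sqrt (cos_transform g v ^+ 2 + sin_transform g v ^+ 2)) ->
    controlled (fun z => f (w * z)).
  move=> cf f1 fL fG; split.
  - have := @measurable_trig f 0 w cf; apply: eq_measurable_fun => z _.
    by rewrite expr0 mul1r.
  - by exists 1 => z _; exact: f1.
  - move=> kappa k0.
    have [d d0 hd] := @L2norm_lipschitz_le _ _ _ _ _ _ low whi L0 k0.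
    exists d => // g gB gd.
    apply: (hd (fun v => \int[mu]_(z in A) (g z * f (v * z))) _ _ (mG g gB)) => //.
    exact: transform_lipschitz.
split; apply: aux.
- exact: continuous_cos.
- exact: cos_max.
- exact: cos_lipschitz.
- by move=> g v; rewrite -sqrtr_sqr ler_wsqrtr// lerDl sqr_ge0.
- exact: continuous_sin.
- exact: sin_max.
- exact: sin_lipschitz.
- by move=> g v; rewrite -sqrtr_sqr ler_wsqrtr// lerDr sqr_ge0.
Qed.

End Controlled.

(** * Indicators of intervals are controlled *)

Section ControlledIndicator.
Context {R : realType}.
Local Notation mu := (@lebesgue_measure R).
Variables (r lo hi B : R).
Hypotheses (r0 : 0 < r) (lohi : lo < hi) (B0 : 0 < B).
Local Notation A := (`](- r), r[%classic : set R).
Local Notation controlled := (controlled r lo hi B).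
Implicit Types (g phi psi : R -> R) (w z K : R) (p : {poly R}).

Lemma controlledZ (c : R) phi : controlled phi -> controlled (fun z => c * phi z).
Proof.
move=> cphi; rewrite (_ : (fun z => _) = (fun z => c * phi z + 0 * phi z)).
  exact: controlled_combination.
by apply/funext => z; rewrite mul0r addr0.
Qed.

Lemma controlledD phi psi : controlled phi -> controlled psi ->
  controlled (fun z => phi z + psi z).
Proof.
move=> cphi cpsi; rewrite (_ : (fun z => _) = (fun z => 1 * phi z + 1 * psi z)).
  exact: controlled_combination.
by apply/funext => z; rewrite !mul1r.
Qed.

(** Differentiating in the frequency multiplies by [z]. This is how analyticity
    of the Fourier transform enters: an open set of frequencies controls all
    moments at each of its points. *)
Lemma controlled_derive_frequency (f : R -> R) k (f' : R -> R) w :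
  (forall x : R, is_derive x 1 f (f' x)) -> (forall x, `|f' x| <= 1) ->
  continuous f' ->
  (forall v, lo < v -> v < hi -> controlled (fun z => z ^+ k * f (v * z))) ->
  lo < w -> w < hi -> controlled (fun z => z ^+ k.+1 * f' (w * z)).
Proof.
move=> df f'1 cf' cf low whi; pose rho := (hi - w) / 2.
have rho0 : 0 < rho by rewrite divr_gt0// subr_gt0.
pose h n : R := rho / n.+1%:R.
have h0 n : 0 < h n by rewrite divr_gt0.
have hrho n : h n <= rho by rewrite ler_pdivrMr// ler_peMr ?ler1n// ltW.
apply: (@controlled_lim _ _ _ _ _ B0 _
  (fun n z => (h n)^-1 * (z ^+ k * f ((h n + w) * z)) +
              (- (h n)^-1) * (z ^+ k * f (w * z))) (r ^+ k.+1)).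
- move=> n; apply: controlled_combination; apply: cf => //.
    by rewrite (lt_trans low)// ltrDr.
  have := hrho n; rewrite /rho; lra.
- exact: measurable_trig.
- move=> n z; rewrite /= in_itv/= -ltr_norml => /ltW zr.
  rewrite mulNr -mulrBr -mulrBr mulrCA normrM normrX exprSr ler_pM//.
    by rewrite lerXn2r// nnegrE ltW.
  rewrite normrM normfV (gtr0_norm (h0 n)) ler_pdivrMl//.
  rewrite (le_trans (bounded_derive_lipschitz df f'1 _ _))// mul1r -mulrBl.
  by rewrite addrK normrM (gtr0_norm (h0 n)) ler_pM2l.
- move=> z _.
  have := difference_quotient_cvg rho0 (derive_scale_arg (df (w * z))).
  move=> /(@cvgMl_tmp _ _ _ _ _ (z ^+ k)).
  rewrite exprSr -mulrA (mulrC z); apply: cvg_trans.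
  by apply: near_eq_cvg; apply: nearW => n; rewrite /h; ring.
Qed.

Lemma controlled_monomial k w : lo < w -> w < hi ->
  controlled (fun z => z ^+ k * cos (w * z)) /\
  controlled (fun z => z ^+ k * sin (w * z)).
Proof.
elim: k w => [|k IH] w low whi.
  have [c1 c2] := controlled_band r0 B0 low whi.
  by split; [move: c1|move: c2]; congr controlled; apply/funext => z;
    rewrite expr0 mul1r.
have c1 := @controlled_derive_frequency cos k (fun x => - sin x) w
  (fun x => is_derive_cos x).
have c2 := @controlled_derive_frequency sin k cos w (fun x => is_derive_sin x).
split.
  apply: c2 => //; [exact: cos_max|exact: continuous_cos|].
  by move=> v lv vh; have [_] := IH v lv vh.
rewrite (_ : (fun z => _) = (fun z => (-1) * (z ^+ k.+1 * - sin (w * z)))).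
  apply: controlledZ; apply: c1 => //.
  - by move=> x; rewrite normrN sin_max.
  - by move=> x; apply: cvgN; exact: continuous_sin.
  - by move=> v lv vh; have [] := IH v lv vh.
by apply/funext => z; ring.
Qed.

Lemma controlled_poly_trig p w : lo < w -> w < hi ->
  controlled (fun z => p.[z] * cos (w * z)) /\
  controlled (fun z => p.[z] * sin (w * z)).
Proof.
move=> low whi.
suff H k : controlled (fun z => z ^+ k * p.[z] * cos (w * z)) /\
    controlled (fun z => z ^+ k * p.[z] * sin (w * z)).
  have [c1 c2] := H 0%N.
  by split; [move: c1|move: c2]; congr controlled; apply/funext => z;
    rewrite expr0 mul1r.
elim/poly_ind: p k => [|p c IH] k.
  have [c1 c2] := controlled_monomial 0 low whi.
  by split; [move: (controlledZ 0 c1)|move: (controlledZ 0 c2)]; congr controlled;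
    apply/funext => z; rewrite horner0 !(mulr0, mul0r).
have [c1 c2] := controlled_monomial k low whi; have [d1 d2] := IH k.+1.
by split; [move: (controlledD d1 (controlledZ c c1))
          |move: (controlledD d2 (controlledZ c c2))];
  congr controlled; apply/funext => z; 
  rewrite hornerMXaddC exprSr; ring.
Qed.

Lemma poly_bounded p : exists K, forall z, A z -> `|p.[z]| <= K.
Proof.
elim/poly_ind: p => [|p c [K pK]].
  by exists 0 => z _; rewrite horner0 normr0.
exists (K * r + `|c|) => z Az; rewrite hornerMXaddC (le_trans (ler_normD _ _))//.
rewrite lerD// normrM ler_pM ?pK//.
by move: Az; rewrite /= in_itv/= -ltr_norml => /ltW.
Qed.

Definition cos_taylor w n : {poly R} :=
  \poly_(i < n) ((~~ odd i)%:R * (-1) ^ i./2 * w ^+ i / i`!%:R).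
Definition sin_taylor w n : {poly R} :=
  \poly_(i < n) ((odd i)%:R * (-1) ^+ i.-1./2 * w ^+ i / i`!%:R).

Lemma cos_taylorE w n z : (cos_taylor w n).[z] = series (cos_coeff (w * z)) n.
Proof.
rewrite horner_poly /series/= big_mkord; apply: eq_bigr => i _.
by rewrite /cos_coeff/= exprMn; ring.
Qed.

Lemma sin_taylorE w n z : (sin_taylor w n).[z] = series (sin_coeff (w * z)) n.
Proof.
rewrite horner_poly /series/= big_mkord; apply: eq_bigr => i _.
by rewrite /sin_coeff/= exprMn; ring.
Qed.

Lemma series_exp_dominated (u : nat -> R) (x c : R) n :
  (forall i, `|u i| <= exp_coeff `|x| i) -> `|x| <= c ->
  `|series u n| <= expR c.
Proof.
move=> ux xc; rewrite (le_trans (ler_norm_sum _ _ _))//.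
apply: (@le_trans _ _ (series (exp_coeff `|x|) n)).
  by apply: ler_sum => i _; exact: ux.
apply: (@le_trans _ _ (expR `|x|)); last by rewrite ler_expR.
apply: nondecreasing_cvgn_le; last exact: is_cvg_series_exp_coeff.
by apply: nondecreasing_series => i _ _; rewrite exp_coeff_ge0.
Qed.

Lemma taylor_coeff_le (b : bool) m i (x : R) :
  `|b%:R * (-1) ^+ m * x ^+ i / i`!%:R| <= exp_coeff `|x| i.
Proof.
have fact0 : (0 : R) < i`!%:R by rewrite ltr0n fact_gt0.
rewrite /exp_coeff/= !normrM normfV (gtr0_norm fact0) normrX ler_pM2r ?invr_gt0//.
rewrite normrX normrN1 expr1n mulr1 -[X in _ <= X]mul1r ler_wpM2r ?exprn_ge0//.
by case: b; rewrite ?normr1 ?normr0.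
Qed.

(** Multiplying by [cos ^ 2 + sin ^ 2 = 1] and expanding one factor of each
    square in powers of [z] removes the modulation. *)
Lemma controlled_poly p : controlled (fun z => p.[z]).
Proof.
have lh := lohi; pose w := (lo + hi) / 2.
have [low whi] : lo < w /\ w < hi by rewrite /w; split; lra.
have [K pK] := poly_bounded p.
have K0 : 0 <= K.
  by apply: le_trans (pK 0 _); rewrite ?normr_ge0//= in_itv/= oppr_lt0 r0.
pose E := expR (`|w| * r).
apply: (@controlled_lim _ _ _ _ _ B0 _
  (fun n z => (p * cos_taylor w n).[z] * cos (w * z) +
              (p * sin_taylor w n).[z] * sin (w * z)) (K * E + K * E)).
- by move=> n; apply: controlledD;
    [have [] := controlled_poly_trig (p * cos_taylor w n) low whi
    |have [] := controlled_poly_trig (p * sin_taylor w n) low whi].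
- by apply: measurable_funTS; apply: continuous_measurable_fun => z;
    exact: continuous_horner.
- move=> n z Az.
  have wz : `|w * z| <= `|w| * r.
    move: Az; rewrite /= in_itv/= -ltr_norml => /ltW zr.
    by rewrite normrM ler_wpM2l.
  have cE : `|series (cos_coeff (w * z)) n| <= E.
    by apply: series_exp_dominated wz => i; exact: taylor_coeff_le.
  have sE : `|series (sin_coeff (w * z)) n| <= E.
    by apply: series_exp_dominated wz => i; exact: taylor_coeff_le.
  have term (s t : R) : `|s| <= E -> `|t| <= 1 -> `|p.[z] * s * t| <= K * E.
    move=> sE' t1; rewrite -[K * E]mulr1 !normrM ler_pM ?mulr_ge0//.
    by rewrite ler_pM ?pK.
  rewrite !hornerM cos_taylorE sin_taylorE (le_trans (ler_normD _ _))//.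
  by rewrite lerD// term ?cos_max ?sin_max.
- move=> z _; rewrite -[X in _ --> X]mulr1 -(cos2Dsin2 (w * z)) mulrDr.
  under eq_fun do rewrite !hornerM cos_taylorE sin_taylorE.
  apply: cvgD; rewrite expr2 mulrA; apply: cvgMr_tmp; apply: cvgMl_tmp.
    by rewrite unlock; exact: is_cvg_series_cos_coeff.
  by rewrite unlock; exact: is_cvg_series_sin_coeff.
Qed.

(** Iterating [sign_step] on a quadratic that is positive exactly on [`]a, b[]
    gives polynomials converging to its sign [s], and [(s + s ^ 2) / 2] is the
    indicator of [s = 1]. *)
Lemma controlled_indic (a b : R) : - r <= a -> a < b -> b <= r ->
  controlled (\1_(`]a, b[%classic) : R -> R).
Proof.
move=> ra ab br.
pose q : {poly R} := (4 * r ^+ 2)^-1 *: (('X - a%:P) * (b%:P - 'X)).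
have qE z : q.[z] = (4 * r ^+ 2)^-1 * ((z - a) * (b - z)) by rewrite !hornerE.
have rr0 : 0 < 4 * r ^+ 2 by rewrite mulr_gt0// exprn_gt0.
have q1 z : A z -> `|q.[z]| <= 1.
  rewrite /= in_itv/= => /andP[zl zr].
  rewrite qE normrM (gtr0_norm (x := _^-1)) ?invr_gt0// ler_pdivrMl// mulr1.
  have -> : 4 * r ^+ 2 = (2 * r) * (2 * r) by ring.
  by rewrite normrM; apply: ler_pM => //; rewrite ler_norml; apply/andP; split; lra.
pose step : {poly R} := 2^-1 *: (3 *: 'X - 'X^3).
pose P n : {poly R} := iter n (fun s => step \Po s) q.
have PE n z : (P n).[z] = iter n sign_step q.[z].
  elim: n => //= n IH; rewrite horner_comp IH /step /sign_step.
  by rewrite !hornerE; field.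
apply: (@controlled_lim _ _ _ _ _ B0 _
  (fun n z => (2^-1 *: (P n + P n ^+ 2)).[z]) 1).
- by move=> n; exact: controlled_poly.
- exact: measurable_indic.
- move=> n z Az; rewrite hornerZ hornerD horner_exp PE.
  have [/(_ n) + _] := iter_sign_step_cvg (q1 z Az).
  move: (iter _ _ _) => s s1; have s2 : `|s ^+ 2| <= 1 by rewrite normrX exprn_ile1.
  rewrite normrM gtr0_norm ?invr_gt0// ler_pdivrMl// mulr1.
  by rewrite (le_trans (ler_normD _ _))//; lra.
- move=> z Az; have [_ cv] := iter_sign_step_cvg (q1 z Az).
  have -> : \1_(`]a, b[%classic) z = 2^-1 * (Num.sg q.[z] + Num.sg q.[z] ^+ 2) :> R.
    rewrite qE sgrM (gtr0_sg (x := _^-1)) ?invr_gt0// mul1r sgrM indicE.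
    have [zab|zab] := boolP (z \in `]a, b[%classic).
      move: zab; rewrite inE /= in_itv/= => /andP[az zb].
      by rewrite !gtr0_sg ?subr_gt0//=; field.
    move: zab; rewrite notin_setE /= in_itv/= => /negP.
    rewrite negb_and -!leNgt => /orP[za|bz].
      rewrite (gtr0_sg (x := b - z)) ?subr_gt0 ?(le_lt_trans za)// mulr1.
      move: za; rewrite le_eqVlt => /predU1P[->|za].
        by rewrite subrr sgr0; ring.
      by rewrite ltr0_sg ?subr_lt0//=; field.
    rewrite (gtr0_sg (x := z - a)) ?subr_gt0 ?(lt_le_trans ab)// mul1r.
    move: bz; rewrite le_eqVlt => /predU1P[->|bz].
      by rewrite subrr sgr0; ring.
    by rewrite ltr0_sg ?subr_lt0//=; field.
  under eq_fun do rewrite hornerZ hornerD horner_exp PE.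
  by apply: cvgMl_tmp; apply: cvgD => //; rewrite expr2; exact: cvgM.
Qed.

End ControlledIndicator.

(** * Pointwise bounds at Lebesgue points *)

Section Stability.
Context {R : realType}.
Local Notation mu := (@lebesgue_measure R).
Variables (r : R).
Local Notation A := (`](- r), r[%classic : set R).
Implicit Types (g : R -> R) (x : R).

Let mA : measurable A. Proof. by []. Qed.
Let fA : (mu A < +oo)%E. Proof. exact: oo_finite. Qed.

Lemma lebesgue_pt_average_cvg (f : R -> R) x (rho : R) : 0 < rho ->
  locally_integrable setT f -> lebesgue_pt f x ->
  (2 * rho / n.+1%:R)^-1 *
    \int[mu]_(y in `](x - rho / n.+1%:R), (x + rho / n.+1%:R)[) f y
    @[n --> \oo] --> f x.
Proof.
move=> rho0 lf fx.
have rn n : 0 < rho / n.+1%:R by rewrite divr_gt0.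
pose rho_ n := PosNum (rn n).
pose E y n := ball (y : R) (rho_ n)%:num.
have nE y : nicely_shrinking y (E y).
  split; first by move=> n; exact: measurable_ball.
  exists (1, rho_); split => //=.
    by rewrite -(mulr0 rho); apply: cvgMl_tmp; exact: cvg_harmonic.
  by move=> n; exact: subset_refl.
  by move=> n; rewrite mul1e.
have := nice_lebesgue_differentiation nE lf fx.
move=> /fine_cvg; apply: cvg_trans; apply: near_eq_cvg; apply: nearW => n.
have rn0 := rn n; rewrite /=.
have -> : mu (E x n) = (2 * rho / n.+1%:R)%:E.
  rewrite lebesgue_measure_ball; last exact: ltW.
  by congr EFin; rewrite /=; ring.
rewrite inver ifF; last by rewrite gt_eqF// -mulrA mulr_gt0.
have iE : mu.-integrable (E x n) (EFin \o f).
  case: lf => mf _ fK; apply/integrableP; split.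
    by apply/measurable_EFinP; exact: measurable_funTS.
  apply: (@le_lt_trans _ _ (\int[mu]_(y in closed_ball x (rho_ n)%:num) `|(f y)%:E|)%E).
    apply: ge0_subset_integral => //.
    - exact: measurable_ball.
    - exact: measurable_closed_ball.
    - by apply: measurableT_comp => //; apply/measurable_EFinP; exact: measurable_funTS.
    - exact: subset_closed_ball.
  by apply: fK => //; exact: closed_ballR_compact.
rewrite fineM//; last first.
  by apply: integrable_fin_num => //; exact: measurable_ball.
by rewrite /E ball_itv.
Qed.

(** Compare the average over [`]c, d[] with averages over small balls
    shrinking to [x], whose limit is [g x]. *)
Lemma lebesgue_pt_bound g g' x (c d h tau : R) :
  square_integrable A g -> square_integrable A g' -> weak_derivative A g g' ->
  lebesgue_pt (g \_ A) x -> - r < x -> x < r -> - r < c -> c < d -> d < r ->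
  `|x - c| <= h -> `|x - d| <= h -> d - c <= h -> 0 < tau ->
  `|g x| <= (d - c)^-1 * `|\int[mu]_(y in `]c, d[) g y| +
            (tau / 2 * \int[mu]_(y in A) (g' y ^+ 2) + (2 * tau)^-1 * (2 * h)).
Proof.
move=> sg sg' wg lgx rx xr rc cd dr xch xdh dch tau0.
have h0 : 0 < h by lra.
pose m := Num.min x c; pose M := Num.max x d.
have mx : m <= x by rewrite ge_min lexx.
have mc : m <= c by rewrite ge_min lexx orbT.
have Mx : x <= M by rewrite le_max lexx.
have Md : d <= M by rewrite le_max lexx orbT.
have rm : - r < m by rewrite lt_min rx rc.
have Mr : M < r by rewrite gt_max xr dr.
have mMh : M - m <= h.
  move: xch xdh; rewrite !ler_norml => /andP[? ?] /andP[? ?].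
  rewrite /M /m; case: (leP x d) => _; case: (leP x c) => _; lra.
(* A margin around [[m, M]] that leaves room for balls centred at [x], keeps
   the enlarged interval inside the domain and its length below [2 * h]. *)
pose s := Num.min (h / 2) (Num.min ((m + r) / 2) ((r - M) / 2)).
have s0 : 0 < s by rewrite !lt_min; apply/and3P; split; lra.
have sh : s <= h / 2 by rewrite ge_min lexx.
have sm : s <= (m + r) / 2 by rewrite !ge_min lexx orbT.
have sM : s <= (r - M) / 2 by rewrite !ge_min lexx !orbT.
have gA : (g \_ A) x = g x by rewrite patchE mem_set//= in_itv/= rx xr.
have ig := square_integrable_integrable mA fA sg.
have lg : locally_integrable setT (g \_ A).
  exact: integrable_locally_restrict.
have := lebesgue_pt_average_cvg s0 lg lgx; rewrite gA.
move/norm_le_cvg; apply=> n /=.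
pose e := s / n.+1%:R.
have e0 : 0 < e by rewrite divr_gt0.
have es : e <= s by rewrite ler_pdivrMr// ler_peMr ?ler1n// ltW.
rewrite -[2 * s / _]mulrA -/e.
have -> : \int[mu]_(y in `](x - e), (x + e)[) (g \_ A) y =
    \int[mu]_(y in `](x - e), (x + e)[) g y.
  apply: eq_Rintegral => y; rewrite inE /= in_itv/= => /andP[y1 y2].
  by rewrite patchE mem_set//= in_itv/=; apply/andP; split; lra.
have P0 : 0 < (2 * e) * (d - c) by rewrite !mulr_gt0// subr_gt0.
have := @weak_derivative_average_diff _ (- r) r (m - s) (M + s) (x - e) (x + e) c d
  tau g g'.
rewrite (_ : x + e - (x - e) = 2 * e); last by ring.
set I1 := \int[mu]_(y in `](x - e), (x + e)[) g y.
set I2 := \int[mu]_(y in `]c, d[) g y.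
set W := \int[mu]_(y in A) (g' y ^+ 2).
have -> : - r < m - s by lra. have -> : M + s < r by lra.
have -> : m - s <= x - e by lra. have -> : x - e < x + e by lra.
have -> : x + e <= M + s by lra. have -> : m - s <= c by lra.
have -> : d <= M + s by lra. rewrite cd tau0.
move=> /(_ isT isT isT isT isT isT isT isT isT sg sg' wg) key.
have -> : (2 * e)^-1 * I1 = ((2 * e) * (d - c))^-1 *
    ((d - c) * I1 - 2 * e * I2) + (d - c)^-1 * I2.
  by field; rewrite !gt_eqF// subr_gt0.
rewrite (le_trans (ler_normD _ _))// addrC lerD//.
  by rewrite normrM gtr0_norm// invr_gt0 subr_gt0.
rewrite normrM gtr0_norm ?invr_gt0// ler_pdivrMl//.
apply: le_trans key _; rewrite ler_pM2l// lerD2l ler_wpM2l//.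
  by rewrite invr_ge0 mulr_ge0// ltW.
lra.
Qed.

End Stability.

(** * Stability on bounded sets of Sobolev functions *)

Section StabilityTheorem.
Context {R : realType}.
Local Notation mu := (@lebesgue_measure R).

Lemma common_threshold (P : nat -> R -> Prop) N :
  (forall j d e, P j d -> e <= d -> P j e) ->
  (forall j, (j < N)%N -> exists2 d, 0 < d & P j d) ->
  exists2 d, 0 < d & forall j, (j < N)%N -> P j d.
Proof.
move=> Pmon; elim: N => [|N IH] PN; first by exists 1.
have [j jN|d d0 dP] := IH; first by apply: PN; exact: ltnW.
have [e e0 eP] := PN N (ltnSn N).
exists (Num.min d e); first by rewrite lt_min d0.
move=> j; rewrite ltnS leq_eqVlt => /predU1P[->|jN].
  by apply: Pmon eP _; rewrite ge_min lexx orbT.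
by apply: Pmon (dP _ jN) _; rewrite ge_min lexx.
Qed.

(** Up to a small oscillation, [g x] is the average of [g] over the cell of [x]
    in a fine grid, and these finitely many averages are controlled by the
    band. The grid is fixed by [B] and [eta] before [g] is given. *)
Lemma L2_stability (r lo hi B eta : R) : 0 < r -> lo < hi -> 0 < B -> 0 < eta ->
  exists2 delta : R, 0 < delta & forall g g',
    in_L2_ball r B g -> in_L2_ball r B g' ->
    weak_derivative `](- r), r[ g g' -> (spectral_norm r lo hi g < delta%:E)%E ->
    \int[mu]_(x in `](- r), r[) (g x ^+ 2) <= eta.
Proof.
move=> r0 lohi B0 eta0.
have mA : measurable (`](- r), r[%classic : set R) by [].
have fA := oo_finite (- r) r.
pose sigma := Num.sqrt (eta / (2 * r)).
have sigma0 : 0 < sigma by rewrite sqrtr_gt0 divr_gt0// mulr_gt0.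
have sigma2 : sigma ^+ 2 * (2 * r) = eta.
  rewrite sqr_sqrtr; last by rewrite divr_ge0 ?mulr_ge0// ltW.
  by field; rewrite gt_eqF.
(* The bound [`|g x| <= sigma] is met by splitting [sigma] into [sigma / 2] for
   the cell average and [sigma / 4] for each term of the oscillation. *)
pose tau := sigma / (2 * B).
have tau0 : 0 < tau by rewrite divr_gt0// mulr_gt0.
pose N := (Num.truncn (8 * r / (tau * sigma))).+1.
have Nr : 8 * r / (tau * sigma) < N%:R by exact: truncnS_gt.
have N0 : (0 : R) < N%:R by rewrite ltr0n.
pose h := 2 * r / N%:R.
have h0 : 0 < h by rewrite divr_gt0// mulr_gt0.
have hsmall : h <= tau * sigma / 4.
  rewrite /h ler_pdivrMr//; move: Nr; rewrite (ltr_pdivrMr _ _ (mulr_gt0 tau0 sigma0)) => Nr; lra.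
have hN : N%:R * h = 2 * r by rewrite /h; field; rewrite gt_eqF.
(* The middle half of each cell, whose closure lies inside the domain. *)
pose c (j : nat) := - r + (j%:R + 4^-1) * h.
pose d (j : nat) := - r + (j%:R + 3 / 4) * h.
have dc j : d j - c j = h / 2 by rewrite /d /c; field.
have cell j : (j < N)%N -> [/\ - r < c j, c j < d j & d j < r].
  move=> jN; have jN' : (j%:R + 1 : R) * h <= 2 * r.
    by rewrite -hN ler_pM2r// natr1 ler_nat.
  have j0 : 0 <= (j%:R : R) * h by rewrite mulr_ge0// ltW.
  rewrite /c /d; move: (j%:R : R) jN' j0 => J jN' j0; split; lra.
pose P j e := forall g, in_L2_ball r B g -> (spectral_norm r lo hi g < e%:E)%E ->
  `|\int[mu]_(x in `](c j), (d j)[) g x| <= sigma / 2 * (h / 2).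
have [j e e' Pe ee' g gB ge|j jN|delta delta0 small] := @common_threshold P N.
- by apply: Pe => //; rewrite (lt_le_trans ge)// lee_fin.
- have [rc cd dr] := cell j jN.
  have [_ _ /(_ (sigma / 2 * (h / 2)))] :=
    controlled_indic r0 lohi B0 (ltW rc) cd (ltW dr).
  have sh0 : 0 < sigma / 2 * (h / 2) by have := mulr_gt0 sigma0 h0; lra.
  move=> /(_ sh0)[e e0 eP]; exists e => // g gB ge.
  rewrite -(@Rintegral_mul_indic _ `](- r), r[); first exact: eP.
  by apply: subset_itv; rewrite bnd_simp ltW.
exists delta => // g g' gB g'B wg gd.
have [sg _] := gB; have [sg' g'2] := g'B.
have ig := square_integrable_integrable mA fA sg.
have pt x : lebesgue_pt (g \_ `](- r), r[) x -> - r < x -> x < r -> `|g x| <= sigma.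
  move=> lx rx xr.
  pose j := Num.truncn ((x + r) / h).
  have xrh : 0 <= (x + r) / h by rewrite divr_ge0 ?ltW//; lra.
  have /andP[j1 j2] : j%:R * h <= x + r < j.+1%:R * h.
    by rewrite -ler_pdivlMr// -ltr_pdivrMr// truncn_itv.
  have jN : (j < N)%N.
    rewrite -(ltr_nat R) -(ltr_pM2r h0) hN; lra.
  have [rc cd dr] := cell j jN.
  have := small j jN g gB gd.
  have {}j2 : x + r < (j%:R + 1) * h by rewrite natr1.
  have := @lebesgue_pt_bound _ r g g' x (c j) (d j) h tau sg sg' wg lx rx xr
    rc cd dr.
  rewrite dc => key sm; apply: (le_trans (key _ _ _ tau0)).
  - by rewrite ler_norml /c; apply/andP; split; lra.
  - by rewrite ler_norml /d; apply/andP; split; lra.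
  - lra.
  have e1 : (h / 2)^-1 * `|\int[mu]_(y in `](c j), (d j)[) g y| <= sigma / 2.
    have hh : 0 < h / 2 by lra.
    by rewrite (ler_pdivrMl _ _ hh) (mulrC (h / 2)).
  have e2 : tau / 2 * \int[mu]_(y in `](- r), r[) (g' y ^+ 2) <= sigma / 4.
    have -> : sigma / 4 = tau / 2 * B by rewrite /tau; field; rewrite gt_eqF.
    by apply: ler_wpM2l g'2; lra.
  have e3 : (2 * tau)^-1 * (2 * h) <= sigma / 4.
    have -> : (2 * tau)^-1 * (2 * h) = tau^-1 * h by field; rewrite gt_eqF.
    by rewrite (ler_pdivrMl _ _ tau0); lra.
  lra.
have ae_le : (\int[mu]_(x in `](- r)%R, r[) (g x ^+ 2)%:E <=
    \int[mu]_(x in `](- r)%R, r[) (cst (sigma ^+ 2)%:E x))%E.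
  apply: ae_ge0_le_integral => //.
  - by move=> x _; rewrite lee_fin sqr_ge0.
  - exact: measurable_int sg.2.
  - by move=> x _; rewrite lee_fin sqr_ge0.
  - have := lebesgue_differentiation (integrable_locally_restrict mA ig).
    apply: filterS; first exact: (ae_filter_ringOfSetsType mu).
    move=> x lx; rewrite /= in_itv/= => /andP[rx xr].
    rewrite lee_fin -(real_normK (num_real (g x))) lerXn2r ?nnegrE ?(ltW sigma0)//.
    exact: pt.
rewrite -lee_fin /Rintegral fineK; last exact: integrable_fin_num sg.2.
apply: le_trans ae_le _; rewrite integral_cst//.
rewrite [X in (_ * X)%E](_ : _ = (2 * r)%:E) -?EFinM ?sigma2//.
have -> : 2 * r = r - - r by ring.
by apply: measure_oo; lra.
Qed.

End StabilityTheorem.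

(** * Sobolev functions and their Fourier transforms *)

Section Sobolev.
Context {R : realType}.
Local Notation mu := (@lebesgue_measure R).
Implicit Types (f g phi : R -> R) (w : R).

Lemma inL2_square_integrable A f : measurable A -> inL2 A f ->
  square_integrable A f.
Proof.
move=> mA fL2; split.
  have /andP[mf _] := fL2; move: mf; rewrite inE /= => mf.
  exact: ((measurable_restrictT f mA).2 mf).
have := (@integrable_mkcond _ _ _ mu A (EFin \o (fun x => f x ^+ 2)) mA).2; apply.
have := Lfun2_integrable_sqr fL2; congr (mu.-integrable _ _).
by apply/funext => x; rewrite /= !patchE; case: ifP => //; rewrite expr0n.
Qed.

Lemma L2norm_sqr_fin A f : measurable A -> square_integrable A f ->
  (L2norm A f ^+ 2 = (\int[mu]_(x in A) (f x ^+ 2))%:E)%E.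
Proof.
by move=> mA [_ i2]; rewrite L2norm_sqr /Rintegral fineK//; exact: integrable_fin_num i2.
Qed.

Lemma weakDP A f : inH1 A f -> inL2 A (weakD A f) /\ weak_derivative A f (weakD A f).
Proof. by move=> [_ fH1]; apply: (xgetPex (cst 0) fH1). Qed.

Lemma H1norm_bound A f (M : R) : measurable A -> inH1 A f -> 0 <= M ->
  (H1norm A f <= M%:E)%E ->
  \int[mu]_(x in A) (f x ^+ 2) <= M ^+ 2 /\
  \int[mu]_(x in A) (weakD A f x ^+ 2) <= M ^+ 2.
Proof.
move=> mA fH1 M0; have [Df _] := weakDP fH1; have [fL2 _] := fH1.
rewrite /H1norm !L2norm_sqr_fin//; [|exact: inL2_square_integrable..].
set a := \int[mu]_(x in A) _; set b := \int[mu]_(x in A) _.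
have a0 : 0 <= a by apply: Rintegral_ge0 => x _; exact: sqr_ge0.
have b0 : 0 <= b by apply: Rintegral_ge0 => x _; exact: sqr_ge0.
rewrite -EFinD poweR_EFin lee_fin powR12_sqrt ?addr_ge0// => abM.
have : a + b <= M ^+ 2.
  by rewrite -(sqr_sqrtr (addr_ge0 a0 b0)) lerXn2r// nnegrE sqrtr_ge0.
by split; lra.
Qed.

Lemma square_integrableB A f g (K : R) : measurable A ->
  square_integrable A f -> square_integrable A g ->
  \int[mu]_(x in A) (f x ^+ 2) <= K -> \int[mu]_(x in A) (g x ^+ 2) <= K ->
  square_integrable A (fun x => f x - g x) /\
  \int[mu]_(x in A) ((f x - g x) ^+ 2) <= 4 * K.
Proof.
move=> mA [mf f2] [mg g2] fK gK.
have i22 := integrable_add mA (integrable_scale mA 2 f2) (integrable_scale mA 2 g2).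
have le x : (f x - g x) ^+ 2 <= 2 * f x ^+ 2 + 2 * g x ^+ 2.
  by have := sqr_ge0 (f x + g x); nra.
have sB : square_integrable A (fun x => f x - g x).
  split; first exact: measurable_funB.
  apply: (integrable_le mA _ i22); first by apply: measurable_funX; exact: measurable_funB.
  by move=> x _; rewrite ger0_norm ?sqr_ge0.
split => //.
apply: (@le_trans _ _ (\int[mu]_(x in A) (2 * f x ^+ 2 + 2 * g x ^+ 2))).
  by apply: le_Rintegral => //; exact: sB.2.
rewrite RintegralD//; [|exact: integrable_scale..].
by rewrite !RintegralZl//; lra.
Qed.

Lemma derivable_bounded (a b : R) phi : (forall x : R, derivable phi x 1) ->
  exists K, forall x, `]a, b[%classic x -> `|phi x| <= K.
Proof.
move=> dphi; have cphi : continuous phi.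
  by move=> x; apply: differentiable_continuous; exact/derivable1_diffP.
have /compact_bounded[K [_ Kb]] : compact (phi @` `[a, b]).
  by apply: continuous_compact; [exact: continuous_subspaceT|exact: segment_compact].
exists (K + 1) => x xab; apply: (Kb (K + 1)); first by rewrite ltrDl.
by exists x => //; exact: (@subset_itv_oo_cc _ _ a b x).
Qed.

Lemma weak_derivativeB (a b : R) f f' g g' :
  square_integrable `]a, b[ f -> square_integrable `]a, b[ g ->
  square_integrable `]a, b[ f' -> square_integrable `]a, b[ g' ->
  weak_derivative `]a, b[ f f' -> weak_derivative `]a, b[ g g' ->
  weak_derivative `]a, b[ (fun x => f x - g x) (fun x => f' x - g' x).
Proof.
move=> sf sg sf' sg' wf wg phi tphi.
have mA : measurable (`]a, b[%classic : set R) by [].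
have [dphi _] := tphi.
have meas n : measurable_fun `]a, b[ (derive1n n phi).
  apply: measurable_funTS; apply: continuous_measurable_fun => x.
  by apply: differentiable_continuous; apply/derivable1_diffP; exact: dphi.
have i n h : square_integrable `]a, b[ h ->
    mu.-integrable `]a, b[ (EFin \o (fun x => h x * derive1n n phi x)).
  move=> sh; have [K pK] := derivable_bounded a b (dphi n).
  have ih := square_integrable_integrable mA (oo_finite a b) sh.
  exact: (integrable_mul_bounded mA ih (meas n) pK).
have split_int n h k : square_integrable `]a, b[ h -> square_integrable `]a, b[ k ->
    \int[mu]_(x in `]a, b[) ((h x - k x) * derive1n n phi x) =
    \int[mu]_(x in `]a, b[) (h x * derive1n n phi x) -
    \int[mu]_(x in `]a, b[) (k x * derive1n n phi x).
  move=> sh sk; rewrite -RintegralB//; [|exact: i..].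
  by apply: eq_Rintegral => x _; rewrite mulrBl.
have := split_int 1%N f g sf sg; have := split_int 0%N f' g' sf' sg'.
rewrite /= wf// wg// => -> ->; ring.
Qed.

Lemma fourierE (r : R) f w :
  fourier `](- r), r[ f w = (cos_transform r f w +i* sin_transform r f (- w))%C.
Proof.
rewrite /fourier /cintegral /cos_transform /sin_transform.
rewrite [X in _ = (X +i* _)%C]Rintegral_mkcond [X in _ = (_ +i* X)%C]Rintegral_mkcond.
by congr (_ +i* _)%C; apply: eq_Rintegral => x _; rewrite /= !patchE;
  case: ifP => _; rewrite !mul0r ?subr0 ?addr0 ?cosN ?mulNr.
Qed.

Lemma fourier_dist (r : R) f g w :
  square_integrable `](- r), r[ f -> square_integrable `](- r), r[ g ->
  let d x := f x - g x in
  Normc.normc (fourier `](- r), r[ f w - fourier `](- r), r[ g w) =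
  Num.sqrt (cos_transform r d w ^+ 2 + sin_transform r d w ^+ 2).
Proof.
move=> sf sg d.
have mA : measurable (`](- r), r[%classic : set R) by [].
have fA := oo_finite (- r) r.
have i (h t : R -> R) v : square_integrable `](- r), r[ h -> continuous t ->
    (forall x, `|t x| <= 1) ->
    mu.-integrable `](- r), r[ (EFin \o (fun x => h x * t (v * x))).
  move=> sh ct t1; have mt := @measurable_trig R r t 0 v ct.
  apply: (integrable_mul_bounded (K := 1) mA) => //.
    exact: (square_integrable_integrable mA fA sh).
  by move: mt; apply: eq_measurable_fun => x _; rewrite expr0 mul1r.
have diff (t : R -> R) v : continuous t -> (forall x, `|t x| <= 1) ->
    \int[mu]_(x in `](- r), r[) (f x * t (v * x)) -
    \int[mu]_(x in `](- r), r[) (g x * t (v * x)) =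
    \int[mu]_(x in `](- r), r[) (d x * t (v * x)).
  move=> ct t1; rewrite -RintegralB//; [|exact: i..].
  by apply: eq_Rintegral => x _; rewrite mulrBl.
have odd h v : square_integrable `](- r), r[ h ->
    sin_transform r h (- v) = - sin_transform r h v.
  move=> sh; rewrite /sin_transform -[RHS]mulN1r -RintegralZl//.
    by apply: eq_Rintegral => x _; rewrite mulNr sinN mulrN mulN1r.
  by apply: i => //; [exact: continuous_sin|exact: sin_max].
rewrite !fourierE !odd//= /cos_transform /sin_transform.
rewrite -opprD sqrrN diff ?diff//; by [exact: continuous_cos|exact: cos_max
  |exact: continuous_sin|exact: sin_max].
Qed.

End Sobolev.

(** * The stability estimate *)

Theorem theorem2p7 (R : realType) (r omega0 omega1 M eps : R)
    (r_gt0 : 0 < r) (omega0_gt0 : 0 < omega0) (omega01 : omega0 < omega1)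
    (M_gt0 : 0 < M) (eps_gt0 : 0 < eps) (eps_lt1 : eps < 1) :
  exists xi : R, forall f fapp : R -> R,
    inH1 `](- r), r[ f -> inH1 `](- r), r[ fapp ->
    (H1norm `](- r)%R, r[ f <= M%:E)%E -> (H1norm `](- r)%R, r[ fapp <= M%:E)%E ->
    let D := L2normC `]omega0, omega1[
      (fun w => fourier `](- r), r[ f w - fourier `](- r), r[ fapp w) in
    (L2norm `](- r)%R, r[ (fun x => f x - fapp x)%R ^+ 2 <=
       ((8 * pi * M ^+ 2) `^ eps / pi * xi ^+ 2)%:E * D `^ (2 - 2 * eps)
       + (pi^-1)%:E * D ^+ 2
       + (8 / omega1 ^+ 2 * M ^+ 2)%:E)%E.
Proof.
have mA : measurable (`](- r), r[%classic : set R) by [].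
have M2 : 0 < M ^+ 2 by exact: exprn_gt0.
have B0 : 0 < 4 * M ^+ 2 by exact: mulr_gt0.
have pi0 : 0 < pi :> R by exact: pi_gt0.
pose eta := 8 / omega1 ^+ 2 * M ^+ 2.
have eta0 : 0 < eta.
  by rewrite mulr_gt0// divr_gt0// exprn_gt0// (lt_trans omega0_gt0).
have [delta delta0 stable] := L2_stability r_gt0 omega01 B0 eta0.
pose C := (8 * pi * M ^+ 2) `^ eps / pi.
have C0 : 0 < C by rewrite divr_gt0// powR_gt0// !mulr_gt0.
pose Q := delta `^ (2 - 2 * eps).
have Q0 : 0 < Q by rewrite powR_gt0.
exists (Num.sqrt (4 * M ^+ 2 / (C * Q))); move=> f h fH1 hH1 fM hM.
lazy zeta; set D := L2normC _ _.
have [f2M Df2M] := H1norm_bound mA fH1 (ltW M_gt0) fM.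
have [h2M Dh2M] := H1norm_bound mA hH1 (ltW M_gt0) hM.
have [Df wf] := weakDP fH1; have [Dh wh] := weakDP hH1.
have sf := inL2_square_integrable mA fH1.1.
have sh := inL2_square_integrable mA hH1.1.
have sDf := inL2_square_integrable mA Df.
have sDh := inL2_square_integrable mA Dh.
have gB := square_integrableB mA sf sh f2M h2M.
have DgB := square_integrableB mA sDf sDh Df2M Dh2M.
have wg := weak_derivativeB sf sh sDf sDh wf wh.
have DE : D = spectral_norm r omega0 omega1 (fun x => f x - h x).
  rewrite /D /L2normC /spectral_norm; congr (L2norm _ _).
  by apply/funext => w; exact: fourier_dist.
have D0 : (0 <= D)%E by exact: Lnorm_ge0.
have D20 : (0 <= D ^+ 2)%E by rewrite expe_ge0.
rewrite (L2norm_sqr_fin mA gB.1).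
have piD0 : (0 <= (pi^-1)%:E * D ^+ 2)%E.
  by rewrite mule_ge0// lee_fin invr_ge0 ltW.
have xi2 : 0 <= 4 * M ^+ 2 / (C * Q).
  by rewrite divr_ge0 ?(ltW B0)// ltW// mulr_gt0.
(* Below the threshold the last term suffices; above it [xi] makes the first
   term exceed the trivial bound [4 * M ^+ 2]. *)
have [Dlt|deltaD] := ltP D delta%:E.
  have := stable _ _ gB DgB wg; rewrite -DE => /(_ Dlt) small.
  apply: (@le_trans _ _ eta%:E); first by rewrite lee_fin.
  rewrite leeDr// adde_ge0// mule_ge0 ?poweR_ge0//.
  by rewrite lee_fin mulr_ge0 ?sqr_ge0// ltW.
apply: (@le_trans _ _ (4 * M ^+ 2)%:E); first by rewrite lee_fin; exact: gB.2.
rewrite -addeA; apply: (@le_trans _ _ ((C * Num.sqrt (4 * M ^+ 2 / (C * Q)) ^+ 2)%:E *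
    D `^ (2 - 2 * eps))%E); last first.
  by rewrite leeDl// adde_ge0// lee_fin ltW.
have QD : (Q%:E <= D `^ (2 - 2 * eps))%E.
  rewrite -poweR_EFin gt0_ler_poweR//.
  - by rewrite subr_ge0 -[leRHS]mulr1 ler_pM2l// ltW.
  - by rewrite in_itv/= lee_fin (ltW delta0) leey.
  - by rewrite in_itv/= D0 leey.
rewrite sqr_sqrtr//.
have -> : (4 * M ^+ 2)%:E = ((C * (4 * M ^+ 2 / (C * Q)))%:E * Q%:E)%E.
  by rewrite -EFinM; congr EFin; field; rewrite !gt_eqF.
by rewrite lee_wpmul2l// lee_fin mulr_ge0// ltW.
Qed.
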